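(* Let $p=(p(n),\,n\in\mathbb{N})$ be a probability distribution on $\mathbb{N}$ with $p(0)>0$, $p(0)+p(1)<1$ and $\sum_{n\ge 0} n\,p(n)=1$ (critical offspring distribution). Let $q:\mathbb{N}\to[0,1]$ be a mark function such that $p(k)q(k)>0$ for some $k\in\mathbb{N}$. Let $(\tau,\mathcal{M}(\tau))$ be a marked Galton-Watson tree with offspring distribution $p$ and mark function $q$, and let $M(\tau)=\mathrm{Card}(\mathcal{M}(\tau))$. For every $n\in\mathbb{N}^*$ with $\mathbb{P}(M(\tau)=n)>0$, let $\tau_n$ be a random tree whose distribution is the conditional distribution of $\tau$ given $\{M(\tau)=n\}$. Let $\tau^*$ be a Kesten's tree associated with $p$. Then $$\lim_{n\to+\infty}\mathrm{dist}(\tau_n)=\mathrm{dist}(\tau^* )$$ (convergence in distribution for the local topology on trees), where the limit is taken along the set of integers $n$ for which $\mathbb{P}(M(\tau)=n)>0$.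
   Context: $\mathbb{N}=\{0,1,2,\dots\}$, $\mathbb{N}^*=\{1,2,\dots\}$. Trees. $\mathcal{U}=\bigcup_{n\ge 0}(\mathbb{N}^* )^n$ is the set of finite words of positive integers (with $(\mathbb{N}^* )^0=\{\emptyset\}$); $|u|$ is the length of $u$, $uv$ is concatenation. A tree $\mathbf{t}$ is a subset of $\mathcal{U}$ containing $\emptyset$ (the root), closed under taking prefixes (ancestors), and such that for every $u\in\mathbf{t}$ there is $k_u(\mathbf{t})\in\mathbb{N}$ (the number of children, or out-degree, of $u$) such that for $i\in\mathbb{N}^*$, $ui\in\mathbf{t}$ iff $1\le i\le k_u(\mathbf{t})$. Set $k_u(\mathbf{t})=-1$ if $u\notin\mathbf{t}$. $\mathbb{T}$ is the set of trees. Local topology. A sequence $(\mathbf{t}_n)$ in $\mathbb{T}$ converges locally to $\mathbf{t}\in\mathbb{T}$ iff $\lim_n k_u(\mathbf{t}_n)=k_u(\mathbf{t})$ for all $u\in\mathcal{U}$. $\mathrm{dist}(T)$ is the distribution of the $\mathbb{T}$-valued random variable $T$, and $\lim_n\mathrm{dist}(T_n)=\mathrm{dist}(T)$ means convergence in distribution with respect to this topology. Galton-Watson tree. A Galton-Watson tree with offspring distribution $p$ is the usual random element of $\mathbb{T}$ in which vertices have independent numbers of children with law $p$. Marks. Given a fixed tree $\mathbf{t}$ and a mark function $q:\mathbb{N}\to[0,1]$, let $(Z_u(\mathbf{t}),\,u\in\mathbf{t})$ be independent Bernoulli variables with $\mathbb{P}(Z_u(\mathbf{t})=1)=q(k_u(\mathbf{t}))$.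 The set of marked vertices is $\mathcal{M}(\mathbf{t})=\{u\in\mathbf{t}:Z_u(\mathbf{t})=1\}$ and $M(\mathbf{t})$ is its cardinality. A marked Galton-Watson tree with offspring distribution $p$ and mark function $q$ is a pair $(\tau,\mathcal{M}(\tau))$ where $\tau$ is a Galton-Watson tree with offspring distribution $p$ and, conditionally on $\{\tau=\mathbf{t}\}$, $\mathcal{M}(\tau)$ is distributed as $\mathcal{M}(\mathbf{t})$. Kesten's tree. With $p^*(n)=n\,p(n)/\mu$, where $\mu=\sum_n n\,p(n)$ (here $\mu=1$), Kesten's tree $\tau^*$ is the infinite random tree with a unique infinite sequence $(v_k)_{k\ge1}$ of positive integers such that $v_1\cdots v_h\in\tau^*$ for all $h\in\mathbb{N}$ (the word being $\emptyset$ if $h=0$), whose joint law with $(v_k)$ is given recursively: for each $h\in\mathbb{N}$, conditionally given $(v_1,\dots,v_h)$ and $\{u\in\tau^*:|u|\le h\}$, the numbers of children $(k_u(\tau^* ),\,u\in\tau^*,|u|=h)$ are independent, with law $p$ if $u\ne v_1\cdots v_h$ and law $p^*$ if $u=v_1\cdots v_h$; and given $\{u\in\tau^*:|u|\le h+1\}$ and $(v_1,\dots,v_h)$, $v_{h+1}$ is uniform on $\{1,\dots,k_{v_1\cdots v_h}(\tau^* )\}$. *)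

(* Defs.v *)
From HB Require Import structures.
From mathcomp Require Import all_boot all_order all_algebra finmap.
From mathcomp Require Import all_classical all_reals all_analysis.
Import Order.TTheory GRing.Theory Num.Theory.
Import numFieldNormedType.Exports.

Set Implicit Arguments.
Unset Strict Implicit.
Unset Printing Implicit Defensive.

Local Open Scope classical_set_scope.
Local Open Scope ring_scope.

(* Words are sequences of naturals; positivity of the letters is imposed on
   the vertices of a tree, so a tree is a subset of the words over N^*.       *)
Definition word := seq nat.

Record tree := Tree {
  tree_mem :> word -> Prop;
  tree_root : tree_mem [::];
  tree_letters : forall u, tree_mem u -> all (fun i => 0 < i)%N u;
  tree_prefix : forall u v, tree_mem (u ++ v) -> tree_mem u;
  tree_children : forall u, tree_mem u ->
    exists k : nat, forall i : nat, (0 < i)%N ->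
      (tree_mem (rcons u i) <-> (i <= k)%N) }.

Definition nb_children (t : tree) (u : word) : nat :=
  xget 0%N
    [set k | forall i : nat, (0 < i)%N -> (t (rcons u i) <-> (i <= k)%N)].

Lemma nb_childrenP (t : tree) (u : word) : t u ->
  forall i : nat, (0 < i)%N -> (t (rcons u i) <-> (i <= nb_children t u)%N).
Proof.
move=> tu; have [k kP] := tree_children tu.
by rewrite /nb_children; case: xgetP => [y _ //|/(_ k)]; case.
Qed.

(* k_u(t), with the value -1 when u is not a vertex of t *)
Definition outdeg (t : tree) (u : word) : int :=
  if `[< t u >] then (nb_children t u)%:Z else -1.

Definition generation (t : tree) (h : nat) : set word :=
  [set u | t u /\ size u = h].

(* [fsbig] products over an infinite support are 1 by convention; this lemma
   shows that the convention is never used for products over a generation.    *)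
Lemma finite_generation (t : tree) (h : nat) : finite_set (generation t h).
Proof.
elim: h => [|h IH].
  apply: (sub_finite_set _ (finite_set1 ([::] : word))).
  by move=> u [_ /size0nil ->].
pose K (u : word) := [set rcons u i | i in `I_(nb_children t u).+1].
apply: (@sub_finite_set _ _ (\bigcup_(u in generation t h) K u)).
  move=> u; case/lastP: u => [[]//|u i] [tui].
  rewrite size_rcons => -[szu].
  have tu : t u by apply: (@tree_prefix t u [:: i]); rewrite cats1.
  exists u => //; exists i => //=; rewrite ltnS.
  apply/(nb_childrenP tu) => //.
  by have := tree_letters tui; rewrite all_rcons => /andP[].
by apply: bigcup_finite => // u _; exact/finite_image/finite_II.
Qed.

Definition same_upto (h : nat) (s t : tree) : Prop :=
  forall u, (size u <= h)%N -> (s u <-> t u).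

Lemma root_tree_prefix (u v : word) : [::] = u ++ v -> [::] = u.
Proof. by case: u. Qed.

Lemma root_tree_children (u : word) : [::] = u ->
  exists k : nat, forall i : nat, (0 < i)%N ->
    ([::] = rcons u i <-> (i <= k)%N).
Proof. by move=> <-; exists 0%N => -[|i] // _; split. Qed.

Definition root_tree : tree :=
  @Tree (fun u => [::] = u) erefl
    (fun u (e : [::] = u) => let: erefl := e in isT)
    root_tree_prefix root_tree_children.

HB.instance Definition _ := gen_eqMixin tree.
HB.instance Definition _ := gen_choiceMixin tree.
HB.instance Definition _ := isPointed.Build tree root_tree.

(* The local topology is the coarsest one making t |-> k_u(t) continuous for
   every word u, the integers being discrete; see [local_cvgE].               *)
Definition outdegs (t : tree) : {ptws word -> discrete_topology int} :=
  outdeg t.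
HB.instance Definition _ := Topological.copy tree (initial_topology outdegs).

Lemma local_cvgE (t_ : nat -> tree) (t : tree) :
  t_ @ \oo --> t <->
  forall u, (fun n => outdeg (t_ n) u : discrete_topology int) @ \oo -->
            (outdeg t u : discrete_topology int).
Proof.
split=> [tcvg u|kcvg].
  have cu : continuous
      (fun s : tree => outdegs s u : discrete_topology int).
    move=> s; have c1 := @initial_continuous _ _ outdegs s.
    have c2 := @proj_continuous _ (fun=> discrete_topology int) u (outdegs s).
    exact: (cvg_comp _ _ c1 c2).
  exact: (cvg_comp _ _ tcvg (cu t)).
have kcvg' : (fun n => outdegs (t_ n)) @ \oo --> outdegs t.
  apply/cvg_sup => u U [V] [[W] oW <-] Wu WU.
  have [N _ NW] := kcvg u W (open_nbhs_nbhs (conj oW Wu)).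
  by exists N => // n Nn; apply: WU; exact: NW.
move=> A [_ [[B oB <-] Bt] BA].
have [N _ NB] := kcvg' B (open_nbhs_nbhs (conj oB Bt)).
by exists N => // n Nn; apply: BA; exact: NB.
Qed.

HB.instance Definition _ :=
  Measurable.copy tree (g_sigma_algebraType (@open tree)).

Section Definitions.
Context {R : realType}.

Definition is_pmf (p : nat -> R) : Prop :=
  (forall n, 0 <= p n) /\ (\sum_(0 <= n <oo) (p n)%:E = 1)%E.

Definition mean (p : nat -> R) : \bar R :=
  (\sum_(0 <= n <oo) (n%:R * p n)%:E)%E.

Definition size_biased (p : nat -> R) (n : nat) : R :=
  n%:R * p n / fine (mean p).

Definition cond_prob d (T : measurableType d) (P : probability T R)
    (A B : set T) : R :=
  fine (P (A `&` B)) / fine (P B).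

(* Conditionally on the tree up to height h (a discrete random variable), the
   numbers of children of the vertices at height h are i.i.d. with law p.     *)
Definition is_GW (p : nat -> R) d (Om : measurableType d)
    (P : probability Om R) (tau : {RV P >-> tree}) : Prop :=
  forall (h : nat) (t : tree),
    let B := [set w | same_upto h (tau w) t] in
    (0 < P B)%E ->
    forall n : word -> nat,
      cond_prob P
        [set w | forall u, generation t h u -> outdeg (tau w) u = (n u)%:Z] B =
      \big[*%R/1]_(u \in generation t h) p (n u).

(* Probability that u belongs to the set M(t) of marked vertices of t *)
Definition mark_prob (q : nat -> R) (t : tree) (u : word) : R :=
  if `[< t u >] then q (nb_children t u) else 0.

(* Law of (1_{u in M(t)}, u in F) for a fixed tree t: independent Bernoulli *)
Definition marks_pmf (q : nat -> R) (t : tree) (F : {fset word})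
    (z : word -> bool) : R :=
  \prod_(u <- F) bernoulli_pmf (mark_prob q t u) (z u).

(* "Conditionally on tau = t, the random set M is distributed as M(t)" is
   expressed by disintegration with respect to tau, on the finite-dimensional
   marginals of M.                                                            *)
Definition is_marked_GW (p q : nat -> R) d (Om : measurableType d)
    (P : probability Om R) (tau : {RV P >-> tree}) (M : Om -> set word) :
    Prop :=
  [/\ is_GW p tau,
      forall u, measurable [set w | M w u] &
      forall (A : set tree) (F : {fset word}) (z : word -> bool),
        measurable A ->
        (P (tau @^-1` A `&`
            [set w | forall u, u \in F -> (M w u <-> z u)]) =
         \int[P]_(w in tau @^-1` A) (marks_pmf q (tau w) F z)%:E)%E].

(* The word v_1 ... v_h; the sequence is shifted so that [v k] is v_{k+1} *)
Definition spine Om (v : nat -> Om -> nat) (h : nat) (w : Om) : word :=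
  mkseq (fun k => v k w) h.

Definition is_Kesten (p : nat -> R) d (Om : measurableType d)
    (P : probability Om R) (tau : {RV P >-> tree})
    (v : nat -> {RV P >-> nat}) : Prop :=
  [/\ {ae P, forall w,
        (forall h, tau w (spine v h w)) /\
        (forall b : nat -> nat,
           (forall h, tau w (mkseq b h)) -> forall k, b k = v k w)},
      forall (h : nat) (t : tree) (x : word),
        let B := [set w | same_upto h (tau w) t /\ spine v h w = x] in
        (0 < P B)%E ->
        forall n : word -> nat,
          cond_prob P
            [set w | forall u, generation t h u ->
                       outdeg (tau w) u = (n u)%:Z] B =
          \big[*%R/1]_(u \in generation t h)
            (if u == x then size_biased p (n u) else p (n u)) &
      forall (h : nat) (t : tree) (x : word),
        let B := [set w | same_upto h.+1 (tau w) t /\ spine v h w = x] in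
        (0 < P B)%E ->
        forall i : nat,
          cond_prob P [set w | v h w = i] B =
          if (0 < i <= nb_children t x)%N then (nb_children t x)%:R^-1 else 0].

Definition cvg_in_law (F : set_system nat) (mu_ : nat -> probability tree R)
    (mu : probability tree R) : Prop :=
  forall f : tree -> R, continuous f -> (exists C, forall t, `|f t| <= C) ->
    (\int[mu_ n]_t (f t)%:E @[n --> F] --> \int[mu]_t (f t)%:E)%E.

End Definitions.

(* Main.v *)
(* Let a_n be the law of the number of marks and call the pair (out-degree,
   mark) the type of a vertex, of weight w(k,z).  Exploring the tree one vertex
   at a time, the probability that a forest of j trees has total progeny N and n
   marks is, by the hitting time theorem, (j/N) times the probability that N
   i.i.d. types have degree sum N - j and n marks.  In such a sequence the
   frequency of a type (k,z) is close to w(k,z) outside an event of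
   exponentially small probability, while a_n decays subexponentially along its
   support: if s > 1 and y = E[s^M] were finite, then y > E[y^k] >= y by
   criticality.  Hence (Neveu's argument) removing one vertex of type (k,z) from
   a forest of j trees shows that b_(j+k-1)(n-z) is asymptotically at least
   b_j(n), where b_j(n) is the probability that j trees carry n marks in all,
   divided by j.  No aperiodicity assumption is needed.  Removing the vertices
   of the first h generations one by one, from one tree to z_h trees, gives
   liminf P(tau_n = t up to height h) >= z_h(t) P(tau = t up to height h), and
   the right-hand side is the probability of the same event for Kesten's tree.
   Since these limit probabilities sum to one, the lower bounds give
   convergence in distribution. *)
Require Import Defs.
From HB Require Import structures.
From mathcomp Require Import all_boot all_order all_algebra finmap.
From mathcomp Require Import all_classical all_reals all_analysis.
From mathcomp Require Import measurable_realfun.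
From mathcomp Require Import ring lra zify.
Import Order.TTheory GRing.Theory Num.Theory.
Import numFieldNormedType.Exports.
Local Open Scope classical_set_scope.
Local Open Scope ring_scope.

Set Implicit Arguments.
Unset Strict Implicit.
Unset Printing Implicit Defensive.

(** * Weighted words *)

Section WeightedWords.
Context {R : realType} {T : finType} (w : T -> R).

Fixpoint wordsum (N : nat) (f : seq T -> R) : R :=
  if N is N'.+1 then \sum_t w t * wordsum N' (fun x => f (t :: x))
  else f [::].

Lemma eq_wordsum N f g : (forall x, size x = N -> f x = g x) ->
  wordsum N f = wordsum N g.
Proof.
elim: N f g => [|N IH] f g fg /=; first exact: fg.
by apply: eq_bigr => t _; congr (_ * _); apply: IH => x sx; apply: fg; rewrite /= sx.
Qed.

Lemma wordsumZ N c f : wordsum N (fun x => c * f x) = c * wordsum N f.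
Proof.
elim: N f => [//|N IH] f /=.
by rewrite mulr_sumr; apply: eq_bigr => t _; rewrite IH mulrCA.
Qed.

Lemma wordsumD N f g :
  wordsum N (fun x => f x + g x) = wordsum N f + wordsum N g.
Proof.
elim: N f g => [//|N IH] f g /=.
by rewrite -big_split; apply: eq_bigr => t _ /=; rewrite IH mulrDr.
Qed.

Lemma wordsum_prod N h :
  wordsum N (fun x => \prod_(t <- x) h t) = (\sum_t w t * h t) ^+ N.
Proof.
elim: N => [|N IH] /=; first by rewrite big_nil.
rewrite exprS mulr_suml; apply: eq_bigr => t _.
rewrite -mulrA -IH; congr (_ * _); rewrite -wordsumZ; apply: eq_wordsum => x _.
by rewrite big_cons.
Qed.

Hypothesis w_ge0 : forall t, 0 <= w t.

Lemma ler_wordsum N f g : (forall x, size x = N -> f x <= g x) ->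
  wordsum N f <= wordsum N g.
Proof.
elim: N f g => [|N IH] f g fg /=; first exact: fg.
apply: ler_sum => t _; apply: ler_wpM2l => //.
by apply: IH => x sx; apply: fg; rewrite /= sx.
Qed.

Lemma wordsum_exchange N (g : T -> R) (f : seq T -> R) :
  (forall x y, perm_eq x y -> f x = f y) ->
  wordsum N.+1 (fun x => (\sum_(t <- x) g t) * f x) =
  N.+1%:R * \sum_t w t * g t * wordsum N (fun x => f (t :: x)).
Proof.
elim: N f => [|N IH] f fP.
  by rewrite /= mul1r; apply: eq_bigr => t _; rewrite big_seq1 mulrA.
rewrite [LHS]/=.
have -> : \sum_t w t * (\sum_s w s * wordsum N
     (fun x => (\sum_(r <- [:: t, s & x]) g r) * f [:: t, s & x])) =
  \sum_t (w t * g t * wordsum N.+1 (fun x => f (t :: x)) +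
     w t * wordsum N.+1 (fun x => (\sum_(r <- x) g r) * f (t :: x))).
  apply: eq_bigr => t _; rewrite -mulrA -mulrDr -wordsumZ -wordsumD.
  rewrite -[LHS]/(w t * wordsum N.+1 (fun x => (\sum_(r <- t :: x) g r) * f (t :: x))).
  by congr (_ * _); apply: eq_wordsum => x _; rewrite big_cons mulrDl.
rewrite big_split /= -[in RHS]natr1 mulrDl mul1r addrC; congr (_ + _).
under eq_bigr => t _.
  rewrite (_ : \sum__ _ = wordsum N.+1 (fun x => (\sum_(r <- x) g r) * f (t :: x))) //.
  rewrite IH; last by move=> x y xy; apply: fP; rewrite perm_cons.
  rewrite mulrCA mulr_sumr.
  over.
rewrite -mulr_sumr exchange_big /=; congr (_ * _); apply: eq_bigr => s _.
rewrite mulr_sumr; apply: eq_bigr => t _; rewrite mulrCA; congr (_ * (_ * _)).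
by apply: eq_wordsum => x _; apply: fP; apply/permP => a /=; rewrite addnCA.
Qed.

Hypothesis w_le1 : \sum_t w t <= 1.

Definition chernoff_rate (c e : R) : R :=
  expR (e / c * (c - e) - c * (1 - expR (- (e / c)))).

Lemma chernoff_rate_gt0 c e : 0 < chernoff_rate c e.
Proof. exact: expR_gt0. Qed.

Lemma chernoff_rate_lt1 c e : 0 < c -> 0 < e -> chernoff_rate c e < 1.
Proof.
move=> c0 e0; rewrite /chernoff_rate expR_lt1; set s := e / c.
have s0 : 0 < s by rewrite divr_gt0.
have ce : e = s * c by rewrite /s mulfVK // gt_eqF.
clearbody s.
have es : expR (- s) <= (1 + s)^-1.
  rewrite expRN lef_pV2 ?posrE ?expR_gt0 ?expR_ge1Dx //.
  by rewrite addr_gt0.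
have s1 : (1 + s) * (1 + s)^-1 = 1 by rewrite divff// gt_eqF ?addr_gt0.
rewrite ce.
have i0 : 0 < (1 + s)^-1 by rewrite invr_gt0 addr_gt0.
have h1 : 1 - (1 + s)^-1 = s * (1 + s)^-1.
  by move: s1; set i := (1 + s)^-1; lra.
suff : s * (c - s * c) < c * (1 - (1 + s)^-1) by move=> ?; nra.
rewrite h1 -subr_gt0.
have -> : c * (s * (1 + s)^-1) - s * (c - s * c) = c * s * ((1 + s)^-1 - 1 + s) by ring.
have -> : (1 + s)^-1 - 1 + s = s * (s * (1 + s)^-1).
  by rewrite -h1 mulrBr -h1; ring.
by rewrite !mulr_gt0.
Qed.

Lemma wordsum_count_tail N th e : 0 < w th -> 0 < e ->
  wordsum N (fun x => ((count_mem th x)%:R < (w th - e) * N%:R)%R%:R)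
  <= chernoff_rate (w th) e ^+ N.
Proof.
move=> c0 e0; set c := w th in c0 *; pose s := e / c.
have s0 : 0 < s by rewrite divr_gt0.
pose h t := expR (- (s * (t == th)%:R)) * expR (s * (c - e)).
apply: (@le_trans _ _ (wordsum N (fun x => \prod_(t <- x) h t))).
  apply: ler_wordsum => x sx.
  have -> : \prod_(t <- x) h t =
      expR (s * ((c - e) * N%:R - (count_mem th x)%:R)).
    rewrite -sx {sx}; elim: x => [|t x IH] /=.
      by rewrite big_nil mulr0 subr0 mulr0 expR0.
    rewrite big_cons IH /h -!expRD natrD -[(size x).+1%:R]natr1; congr expR.
    ring.
  case: ltP => [lt|_]; last exact: expR_ge0.
  rewrite -[X in X <= _]expR0 ler_expR.
  by apply/ltW/mulr_gt0; rewrite // subr_gt0.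
rewrite wordsum_prod lerXn2r ?nnegrE //.
- by apply: sumr_ge0 => t _; rewrite !mulr_ge0 ?expR_ge0.
- exact: expR_ge0.
rewrite /h; under eq_bigr do rewrite mulrA.
rewrite -mulr_suml /chernoff_rate -/s expRD mulrC ler_wpM2l ?expR_ge0//.
apply: (@le_trans _ _ (1 - c * (1 - expR (- s)))); last first.
  by apply: le_trans (expR_ge1Dx _) _.
rewrite (bigD1 th) //= eqxx mulr1 -/c.
have : c + \sum_(t | t != th) w t <= 1 by move: w_le1; rewrite (bigD1 th).
rewrite (eq_bigr w); last by move=> t /negPf ->; rewrite mulr0 oppr0 expR0 mulr1.
by move=> ?; nra.
Qed.

(* Neveu: removing a letter [th] costs the factor [count th x / N], which is
   at least [w th - e] outside an event of exponentially small weight. *)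
Lemma wordsum_neveu N th e (f : seq T -> R) : 0 < e < w th ->
  (forall x y, perm_eq x y -> f x = f y) -> (forall x, 0 <= f x <= 1) ->
  (w th - e) * (wordsum N.+1 f - chernoff_rate (w th) e ^+ N.+1) <=
  w th * wordsum N (fun x => f (th :: x)).
Proof.
move=> /andP[e0 ec] fP f01; set c := w th in ec *.
have c0 : 0 < c by apply: lt_trans ec.
have := wordsum_exchange N (fun t => (t == th)%:R) fP.
set S := \sum_t _; have -> : S = w th * wordsum N (fun x => f (th :: x)).
  rewrite /S (bigD1 th) //= eqxx mulr1 big1 ?addr0 // => t /negPf ->.
  by rewrite mulr0 mul0r.
set W := w th * _ => ex.
rewrite -(ler_pM2l (ltr0Sn R N)) -/W -ex mulrCA.
have tail := wordsum_count_tail N.+1 c0 e0.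
rewrite -[X in X <= _]/( (c - e) * (N.+1%:R * (wordsum N.+1 f - chernoff_rate c e ^+ N.+1))).
apply: (@le_trans _ _ ((c - e) * N.+1%:R * (wordsum N.+1 f +
    -1 * wordsum N.+1 (fun x => ((count_mem th x)%:R < (c - e) * N.+1%:R)%R%:R)))).
  rewrite -mulrA ler_pM2l ?subr_gt0 // ler_pM2l ?ltr0Sn // mulN1r lerD2l lerN2.
  exact: tail.
rewrite -wordsumZ -wordsumD -wordsumZ.
apply: (@ler_wordsum N.+1 _ (fun x => (\sum_(t <- x) (t == th)%:R) * f x)) => x _.
have -> : \sum_(t <- x) (t == th)%:R = (count_mem th x)%:R :> R.
  by elim: x => [|t x IH]; rewrite ?big_nil ?big_cons //= IH natrD.
have /andP[f0 f1] := f01 x.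
case: ltP => [lt|ge] /=.
  apply: le_trans (_ : 0 <= _); last by rewrite mulr_ge0.
  apply: mulr_ge0_le0; first by rewrite mulr_ge0 // subr_ge0 ltW.
  by rewrite mulN1r subr_le0.
by rewrite mulr0 addr0 ler_wpM2r.
Qed.

End WeightedWords.

(** * Total progeny and marks of a forest *)

Section Forests.
Context {R : realType} (p q : nat -> R).

Definition type_weight (k : nat) (z : bool) : R :=
  p k * (if z then q k else 1 - q k).

Local Notation tw t := (type_weight (nat_of_ord t.1) t.2).

(* The integral of [g], evaluated at the number of marks, over the forests of
   [j] trees with [N] vertices and out-degrees less than [K].  The cut-off only
   keeps the sums finite; see [forest_cutoff]. *)
Fixpoint forest (K N j : nat) (g : nat -> R) : R :=
  match N, j with
  | 0, 0 => g 0%N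
  | N'.+1, j'.+1 => \sum_(t : 'I_K * bool)
      tw t * forest K N' (j' + t.1) (fun n => g (t.2 + n)%N)
  | _, _ => 0
  end.

Hypothesis p_ge0 : forall k, 0 <= p k.
Hypothesis p_le1 : forall K, \sum_(k < K) p k <= 1.
Hypothesis q01 : forall k, 0 <= q k <= 1.

Lemma type_weight_ge0 k z : 0 <= type_weight k z.
Proof.
have /andP[q0 q1] := q01 k.
by rewrite mulr_ge0 //; case: z; rewrite // subr_ge0.
Qed.

Lemma sum_types K (f : nat -> bool -> R) :
  \sum_(t : 'I_K * bool) f t.1 t.2 = \sum_(k < K) (f k true + f k false).
Proof.
rewrite -(pair_bigA _ (fun (k : 'I_K) z => f k z)) /=.
by apply: eq_bigr => k _; rewrite big_bool.
Qed.

Lemma type_weightD k : type_weight k true + type_weight k false = p k.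
Proof. by rewrite /type_weight; ring. Qed.

Lemma sum_type_weight_le1 K : \sum_(t : 'I_K * bool) tw t <= 1.
Proof.
rewrite (sum_types K type_weight); under eq_bigr do rewrite type_weightD.
exact: p_le1.
Qed.

Lemma eq_forest K N j g g' : (forall n, (n <= N)%N -> g n = g' n) ->
  forest K N j g = forest K N j g'.
Proof.
elim: N j g g' => [|N IH] [|j] g g' gg' //=; first exact: gg'.
apply: eq_bigr => t _; congr (_ * _); apply: IH => n nN; apply: gg'.
by case: t.2 => //=; rewrite add0n ltnW.
Qed.

Lemma forest_sum K N j I (r : seq I) (c : I -> R) (h : I -> nat -> R) :
  forest K N j (fun n => \sum_(i <- r) c i * h i n) =
  \sum_(i <- r) c i * forest K N j (h i).
Proof.
elim: N j h => [|N IH] [|j] h //=; try by rewrite big1 // => i _; rewrite mulr0.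
under eq_bigr => t _ do rewrite IH mulr_sumr.
rewrite exchange_big; apply: eq_bigr => i _; rewrite mulr_sumr.
by apply: eq_bigr => t _; rewrite mulrCA.
Qed.

Lemma forestZ K N j c g : forest K N j (fun n => c * g n) = c * forest K N j g.
Proof.
have := forest_sum K N j [:: tt] (fun=> c) (fun=> g); rewrite big_seq1 => <-.
by apply: eq_forest => n _; rewrite big_seq1.
Qed.

Lemma ler_forest K N j g g' : (forall n, g n <= g' n) ->
  forest K N j g <= forest K N j g'.
Proof.
elim: N j g g' => [|N IH] [|j] g g' gg' //=.
by apply: ler_sum => t _; rewrite ler_wpM2l ?type_weight_ge0 // IH.
Qed.

Lemma forest_ge0 K N j g : (forall n, 0 <= g n) -> 0 <= forest K N j g.
Proof.
elim: N j g => [|N IH] [|j] g g0 //=.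
by apply: sumr_ge0 => t _; rewrite mulr_ge0 ?type_weight_ge0 ?IH.
Qed.

Lemma forest_gt K N j g : (N < j)%N -> forest K N j g = 0.
Proof.
elim: N j g => [|N IH] [|j] g //=; rewrite ltnS => Nj.
by rewrite big1 // => t _; rewrite IH ?mulr0 // (leq_trans Nj) ?leq_addr.
Qed.

Lemma forest_cutoff K K' N j g : (N <= K)%N -> (N <= K')%N ->
  forest K N j g = forest K' N j g.
Proof.
suff H L M : (N <= L)%N -> forest (L + M) N j g = forest L N j g.
  move=> NK NK'; rewrite -[K](subnKC NK) -[K'](subnKC NK').
  by rewrite !H ?leqnn.
elim: N L M j g => [|N IH] L M [|j] g NL //=.
rewrite (sum_types _ (fun k z => type_weight k z *
  forest (L + M) N (j + k) (fun n => g (z + n)%N))).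
rewrite (sum_types _ (fun k z => type_weight k z *
  forest L N (j + k) (fun n => g (z + n)%N))).
rewrite big_split_ord /= [X in _ + X]big1 ?addr0 => [|k _].
  by apply: eq_bigr => k _; rewrite !IH // ltnW.
by rewrite !forest_gt ?mulr0 ?addr0 // addnA; lia.
Qed.

Definition degsum K (x : seq ('I_K * bool)) : nat := \sum_(t <- x) t.1.
Definition marksum K (x : seq ('I_K * bool)) : nat := \sum_(t <- x) t.2.

Definition bridge K (N j : nat) (g : nat -> R) (x : seq ('I_K * bool)) : R :=
  (degsum x + j == N)%N%:R * g (marksum x).

Lemma bridge_perm K N j g (x y : seq ('I_K * bool)) :
  perm_eq x y -> bridge N j g x = bridge N j g y.
Proof. by move=> xy; rewrite /bridge /degsum /marksum !(perm_big _ xy). Qed.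

Lemma bridge_cons K N j g t (x : seq ('I_K * bool)) :
  bridge N.+1 j.+1 g (t :: x) =
  bridge N (j + t.1) (fun n => g (t.2 + n)%N) x.
Proof.
rewrite /bridge /degsum /marksum !big_cons; congr ((nat_of_bool _)%:R * _).
by set S := (\sum_(i <- x) _)%N; apply/eqP/eqP; lia.
Qed.

(* The hitting time theorem (Otter, Dwass, Kemperman), by the induction of
   van der Hofstad and Keane: exchangeability replaces the first step by the
   mean step. *)
Lemma forest_kemperman K N j g :
  N%:R * forest K N j g =
  j%:R * wordsum (fun t : 'I_K * bool => tw t) N (bridge N j g).
Proof.
elim: N j g => [|N IH] [|j] g; rewrite ?mul0r ?mulr0 //.
  by rewrite /= /bridge /degsum /marksum !big_nil mul0r mulr0.
set W := wordsum _ _ _.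
have ex := wordsum_exchange (fun t : 'I_K * bool => tw t) N
  (fun t => (nat_of_ord t.1)%:R) (@bridge_perm K N.+1 j.+1 g).
have WS : W = \sum_t tw t * wordsum (fun t : 'I_K * bool => tw t) N
    (fun x => bridge N.+1 j.+1 g (t :: x)) by [].
move: ex; rewrite (@eq_wordsum _ _ _ _ _
    (fun x => (N%:R - j%:R) * bridge N.+1 j.+1 g x)); last first.
  move=> x _; rewrite /bridge; case: eqP => [e|_]; last by rewrite !mul0r !mulr0.
  rewrite !mul1r; congr (_ * _); move: e; rewrite addnS => -[<-].
  by rewrite natrD addrK /degsum natr_sum.
rewrite wordsumZ -/W => ex.
case: N => [|N] in IH W WS ex *.
  rewrite mul1r WS /= mulr_sumr; apply: eq_bigr => t _.
  rewrite bridge_cons /bridge /degsum /marksum !big_nil add0n.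
  case: j {IH W WS ex} => [|j]; last by rewrite addSn /= !mul0r !mulr0.
  by rewrite add0n mul1r; case: (nat_of_ord t.1) => [|k] /=; rewrite ?mul1r // mul0r.
have : N.+1%:R * forest K N.+2 j.+1 g =
  \sum_(t : 'I_K * bool) (j%:R * (tw t * wordsum (fun t : 'I_K * bool => tw t)
     N.+1 (fun x => bridge N.+2 j.+1 g (t :: x))) +
    tw t * t.1%:R * wordsum (fun t : 'I_K * bool => tw t)
     N.+1 (fun x => bridge N.+2 j.+1 g (t :: x))).
  rewrite [forest _ _ _ _](_ : _ = \sum_(t : 'I_K * bool)
    tw t * forest K N.+1 (j + t.1) (fun n => g (t.2 + n)%N)) // mulr_sumr.
  apply: eq_bigr => t _; rewrite mulrCA IH.
  rewrite (eq_wordsum _ (fun x _ => bridge_cons N.+1 j g t x)) natrD.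
  set Z := wordsum _ _ _; ring.
rewrite big_split -mulr_sumr -WS.
move: ex; set Q := \sum_t tw t * _ * _ => ex fe.
apply: (@mulfI _ N.+1%:R); first by rewrite pnatr_eq0.
rewrite mulrCA fe mulrDr -ex -(natr1 j) -(natr1 N.+1).
ring.
Qed.

Lemma forest_neveu K N i (k : 'I_K) z e g :
  0 < e < type_weight k z -> (0 < i + k)%N -> (forall n, 0 <= g n <= 1) ->
  (type_weight k z - e) * (forest K N.+1 i.+1 g / i.+1%:R -
     chernoff_rate (type_weight k z) e ^+ N.+1) <=
  type_weight k z * (forest K N (i + k) (fun n => g (z + n)%N) / (i + k)%:R).
Proof.
move=> eP ik g01; have /andP[e0 ec] := eP.
have b01 (x : seq ('I_K * bool)) : 0 <= bridge N.+1 i.+1 g x <= 1.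
  rewrite /bridge; case: eqP => _; first by rewrite mul1r.
  by rewrite mul0r lexx ler01.
have := wordsum_neveu (fun t : 'I_K * bool => type_weight_ge0 t.1 t.2)
  (sum_type_weight_le1 K) N (th := (k, z)) eP (@bridge_perm K N.+1 i.+1 g) b01.
rewrite [(k, z).1]/= [(k, z).2]/=.
have ke := forest_kemperman K N.+1 i.+1 g.
have ke' := forest_kemperman K N (i + k) (fun n => g (z + n)%N).
rewrite [X in _ <= _ * X](eq_wordsum _ (fun x _ => bridge_cons N i g (k, z) x)).
rewrite [(k, z).1]/= [(k, z).2]/=.
set r := chernoff_rate _ _.
have r0 : 0 < r ^+ N.+1 by rewrite exprn_gt0 // chernoff_rate_gt0.
set c := type_weight k z in eP ec *.
move: ke ke'; set W := wordsum _ _ _; set W' := wordsum _ N _.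
set F := forest _ N.+1 _ _; set F' := forest _ N _ _ => ke ke' ne.
have -> : F / i.+1%:R = N.+1%:R^-1 * W.
  rewrite -[F](mulKf (x := N.+1%:R)) ?pnatr_eq0 // ke.
  by rewrite -mulrA mulrAC divff ?mul1r // pnatr_eq0.
have W'E : W' = N%:R * (F' / (i + k)%:R).
  by rewrite mulrA ke' mulrAC divff ?mul1r // pnatr_eq0 -lt0n.
have F'0 : 0 <= F' / (i + k)%:R.
  by rewrite divr_ge0 // forest_ge0 // => n; have /andP[] := g01 (z + n)%N.
rewrite -(ler_pM2l (ltr0Sn R N)).
apply: (@le_trans _ _ ((c - e) * (W - r ^+ N.+1))).
  rewrite mulrCA ler_pM2l ?subr_gt0 // mulrBr mulrA divff ?pnatr_eq0 // mul1r.
  by rewrite lerD2l lerN2 ler_peMl ?ler1n // ltW.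
apply: le_trans ne _; rewrite W'E mulrCA ler_wpM2r ?ler_nat //.
by rewrite mulr_ge0 // ltW // (lt_trans e0).
Qed.

Definition forestc K N j g := \sum_(i < N.+1) forest K i j g.

Lemma forestc0 K N g : forestc K N 0 g = g 0%N.
Proof. by rewrite /forestc big_ord_recl big1 ?addr0. Qed.

Lemma forestc0S K j g : forestc K 0 j.+1 g = 0.
Proof. by rewrite /forestc big_ord1. Qed.

Lemma forestcSS K N j g : forestc K N.+1 j.+1 g = \sum_(t : 'I_K * bool)
  tw t * forestc K N (j + t.1) (fun n => g (t.2 + n)%N).
Proof.
rewrite /forestc big_ord_recl add0r /=.
under [RHS]eq_bigr do rewrite mulr_sumr.
by rewrite exchange_big.
Qed.

Lemma forestc_ge0 K N j g : (forall n, 0 <= g n) -> 0 <= forestc K N j g.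
Proof. by move=> g0; apply: sumr_ge0 => i _; apply: forest_ge0. Qed.

Lemma ler_forestc K N j g g' : (forall n, g n <= g' n) ->
  forestc K N j g <= forestc K N j g'.
Proof. by move=> gg'; apply: ler_sum => i _; apply: ler_forest. Qed.

Lemma forestcZ K N j c g :
  forestc K N j (fun n => c * g n) = c * forestc K N j g.
Proof. by rewrite /forestc mulr_sumr; apply: eq_bigr => i _; rewrite forestZ. Qed.

Lemma ler_forestcN K N N' j g : (N <= N')%N -> (forall n, 0 <= g n) ->
  forestc K N j g <= forestc K N' j g.
Proof.
move=> NN' g0; rewrite /forestc -(subnKC NN') -addSn big_split_ord lerDl.
by apply: sumr_ge0 => i _; apply: forest_ge0.
Qed.

Lemma forestc_cutoff K K' N j g : (N <= K)%N -> (N <= K')%N ->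
  forestc K N j g = forestc K' N j g.
Proof.
move=> NK NK'; apply: eq_bigr => i _; apply: forest_cutoff.
  by rewrite (leq_trans _ NK) // -ltnS.
by rewrite (leq_trans _ NK') // -ltnS.
Qed.

Lemma forestc_le1 K N j g : (forall n, 0 <= g n <= 1) -> forestc K N j g <= 1.
Proof.
elim: N j g => [|N IH] [|j] g g01; rewrite ?forestc0 ?forestc0S //.
- by have /andP[] := g01 0%N.
- by have /andP[] := g01 0%N.
rewrite forestcSS; apply: le_trans (sum_type_weight_le1 K).
by apply: ler_sum => t _; rewrite ler_piMr ?type_weight_ge0 // IH.
Qed.

Lemma forestc_expand K N j g : forestc K N j g =
  \sum_(m < N.+1) g m * forestc K N j (fun n => (m == n :> nat)%:R).
Proof.
rewrite /forestc; under [RHS]eq_bigr do rewrite mulr_sumr.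
rewrite exchange_big /=; apply: eq_bigr => i _; rewrite -forest_sum.
apply: eq_forest => n ni.
have nN : (n < N.+1)%N by rewrite (leq_ltn_trans ni).
rewrite (bigD1 (Ordinal nN)) //= eqxx mulr1 big1 ?addr0 // => m mn.
rewrite (_ : (m == n :> nat) = false) ?mulr0 //.
by apply: contra_neqF mn => /eqP mn; apply: val_inj.
Qed.

Lemma forestc_supermul K N N' i j g1 g2 g : (forall n, 0 <= g1 n) ->
  (forall n, 0 <= g2 n) -> (forall a b, g1 a * g2 b <= g (a + b)%N) ->
  forestc K N i g1 * forestc K N' j g2 <= forestc K (N + N') (i + j) g.
Proof.
move=> g10 g20.
have base M g1' g' : (N' <= M)%N -> (forall n, 0 <= g1' n) ->
    (forall a b, g1' a * g2 b <= g' (a + b)%N) ->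
    g1' 0%N * forestc K N' j g2 <= forestc K M j g'.
  move=> NM g10' gg; rewrite -forestcZ; apply: le_trans (_ : forestc K N' j g' <= _).
    by apply: ler_forestc => n; have := gg 0%N n; rewrite add0n.
  apply: ler_forestcN => // n; apply: le_trans (gg 0%N n).
  by rewrite mulr_ge0.
elim: N i g1 g g10 => [|N IH] [|i] g1 g g10 gg.
- by rewrite forestc0 !add0n base.
- by rewrite forestc0S mul0r forestc_ge0 // => n;
   apply: le_trans (gg 0%N n); rewrite mulr_ge0.
- by rewrite forestc0 !add0n base // leq_addl.
rewrite !addSn !forestcSS mulr_suml; apply: ler_sum => t _.
rewrite -mulrA ler_wpM2l ?type_weight_ge0 // addnAC IH // => a b.
by rewrite addnA.
Qed.

End Forests.

Section Series.
Context {R : realType}.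

Lemma nneseries_cvg (u : nat -> R) (r : R) : (forall n, 0 <= u n) ->
  (\sum_(0 <= n <oo) (u n)%:E = r%:E)%E ->
  (fun K => \sum_(k < K) u k) @ \oo --> r.
Proof.
move=> u0 ur.
have : (fun n => \sum_(0 <= k < n) (u k)%:E)%E @ \oo --> r%:E.
  rewrite -ur; apply: (@is_cvg_nneseries _ (fun n => (u n)%:E) xpredT 0%N) => n _ _.
  by rewrite lee_fin.
move=> /fine_cvg; apply: cvg_trans; apply: near_eq_cvg; near=> n.
by rewrite /= sumEFin /= big_mkord.
Unshelve. all: by end_near. Qed.

Lemma ler_nneseries_partial (u : nat -> R) (r : R) K : (forall n, 0 <= u n) ->
  (\sum_(0 <= n <oo) (u n)%:E = r%:E)%E -> \sum_(k < K) u k <= r.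
Proof.
move=> u0 ur; rewrite -lee_fin -ur -(big_mkord xpredT u) -sumEFin.
by apply: nneseries_lim_ge => k _ _; rewrite lee_fin.
Qed.

Lemma bernoulli_le (y : R) k : 0 <= y -> 1 + k%:R * (y - 1) <= y ^+ k.
Proof.
move=> y0; elim: k => [|k IH]; first by rewrite expr0 mul0r addr0.
rewrite exprS; apply: le_trans (ler_wpM2l y0 IH).
rewrite -natr1 -subr_ge0.
have -> : y * (1 + k%:R * (y - 1)) - (1 + (k%:R + 1) * (y - 1)) =
  k%:R * (y - 1) ^+ 2 by ring.
by rewrite mulr_ge0 // sqr_ge0.
Qed.

Lemma bernoulli_eq (y : R) k : 0 <= y -> y ^+ k.+2 <= 1 + k.+2%:R * (y - 1) ->
  y = 1.
Proof.
move=> y0 yk; have H := ler_wpM2l y0 (bernoulli_le k.+1 y0).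
have : k.+1%:R * (y - 1) ^+ 2 <= 0.
  rewrite exprS in yk; have {yk}H := le_trans H yk; rewrite -subr_le0 in H.
  apply: le_trans H; rewrite le_eqVlt; apply/orP; left; apply/eqP.
  by rewrite -[k.+2%:R]natr1; ring.
rewrite pmulr_rle0 // => h; apply/eqP; rewrite -subr_eq0 -sqrf_eq0.
by rewrite eq_le h sqr_ge0.
Qed.

End Series.

Section Critical.
Context {R : realType} (p q : nat -> R).
Hypothesis p_pmf : is_pmf p.
Hypothesis p0 : 0 < p 0%N.
Hypothesis p01 : p 0%N + p 1%N < 1.
Hypothesis p_critical : mean p = 1%E.
Hypothesis q01 : forall k, 0 <= q k <= 1.
Hypothesis pq : exists k, 0 < p k * q k.

Let p_ge0 : forall k, 0 <= p k. Proof. by case: p_pmf. Qed.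

Lemma pmf_partial_le1 K : \sum_(k < K) p k <= 1.
Proof. by case: p_pmf => p_ge p_sum; apply: ler_nneseries_partial. Qed.

Let tw_ge0 := type_weight_ge0 p_ge0 q01.

Lemma exists_branching : exists k, 0 < p k.+2.
Proof.
apply: contrapT => /forallNP H.
have pk k : p k.+2 = 0.
  by apply/eqP; rewrite eq_le p_ge0 andbT leNgt; apply/negP/H.
have /(nneseries_cvg p_ge0) pc := p_pmf.2.
have := p01; rewrite ltNge => /negP; apply.
apply: (@cvgr_to_le _ _ _ _ _ _ _ pc).
exists 2%N => // -[|[|K]] // _; rewrite !big_ord_recl big1 ?addr0 //.
by move=> i _; rewrite -[RHS](pk i).
Qed.

Definition step_gf (s : R) (k : nat) : R := p k * (1 - q k + q k * s).

Lemma step_gf_fixpoint (s y : R) : 1 <= s -> 0 <= y ->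
  (forall K, \sum_(k < K) step_gf s k * y ^+ k <= y) -> s = 1 /\ y = 1.
Proof.
move=> s1 y0 H.
pose d k := step_gf s k * y ^+ k - p k * (1 + k%:R * (y - 1)).
have cp k : p k <= step_gf s k.
  rewrite -[X in X <= _]mulr1; apply: ler_wpM2l => //.
  by have /andP[? ?] := q01 k; nra.
have d_ge0 k : 0 <= d k.
  rewrite subr_ge0; apply: le_trans (ler_wpM2l (p_ge0 k) (bernoulli_le k y0)) _.
  by rewrite ler_wpM2r // exprn_ge0.
have pc := nneseries_cvg p_ge0 p_pmf.2.
have mc : (fun K => \sum_(k < K) k%:R * p k) @ \oo --> (1 : R).
  have np k : 0 <= k%:R * p k by rewrite mulr_ge0.
  exact: (nneseries_cvg np p_critical).
have bc : (fun K => y - (\sum_(k < K) p k + (y - 1) * \sum_(k < K) k%:R * p k))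
    @ \oo --> y - (1 + (y - 1) * 1).
  exact: (cvgB (cvg_cst y) (cvgD pc (cvgM (cvg_cst (y - 1)) mc))).
have d_le0 k0 : d k0 <= 0.
  rewrite [leRHS](_ : _ = y - (1 + (y - 1) * 1)); last by ring.
  apply: (@cvgr_to_ge _ _ _ _ _ _ _ bc); exists k0.+1 => // K /= k0K.
  apply: (@le_trans _ _ (\sum_(k < K) d k)).
    by rewrite (bigD1 (Ordinal k0K)) //= lerDl sumr_ge0.
  rewrite sumrB lerB //; rewrite mulr_sumr -big_split /= le_eqVlt; apply/orP.
  by left; apply/eqP; apply: eq_bigr => k _; ring.
have y_gt0 : 0 < y.
  have := H 1%N; rewrite big_ord1 expr0 mulr1; apply: lt_le_trans.
  exact: lt_le_trans (cp 0%N).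
have y1 : y = 1.
  have [k pk] := exists_branching; apply: (@bernoulli_eq _ _ k) => //.
  rewrite -(ler_pM2l pk); have := d_le0 k.+2; rewrite subr_le0.
  by apply: le_trans; rewrite ler_wpM2r // exprn_ge0.
split=> //; have [k pqk] := pq; have := d_le0 k.
rewrite /d /step_gf y1 expr1n mulr1 subrr mulr0 addr0 => h.
apply/eqP; rewrite eq_le s1 andbT; nra.
Qed.

Lemma forestc_pow K N k (g : nat -> R) : g 0%N = 1 -> (forall n, 0 <= g n) ->
  (forall a b, g (a + b)%N = g a * g b) ->
  forestc p q K N 1 g ^+ k <= forestc p q K (N * k) k g.
Proof.
move=> g0 g_ge0 gM; elim: k => [|k IH]; first by rewrite muln0 forestc0 g0.
rewrite exprS mulnS; apply: (@le_trans _ _ (forestc p q K N 1 g * forestc p q K (N * k) k g)).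
  by rewrite ler_wpM2l // forestc_ge0.
by apply: (@forestc_supermul _ p q _ _ _ _ _ 1) => // a b; rewrite gM.
Qed.

Lemma forestc_step_gf (s : R) K N d : 0 <= s ->
  \sum_(k < K) step_gf s k * forestc p q (K + d) N 1 (fun n => s ^+ n) ^+ k <=
  forestc p q (K + d) (N * K).+1 1 (fun n => s ^+ n).
Proof.
move=> s0; set g := fun n => s ^+ n.
have g_ge0 n : 0 <= g n by rewrite exprn_ge0.
rewrite forestcSS.
rewrite (sum_types _ (fun k z => type_weight p q k z *
  forestc p q (K + d) (N * K) (0 + k) (fun n => g (z + n)%N))).
rewrite big_split_ord /= -[X in X <= _]addr0 lerD //; last first.
  by apply: sumr_ge0 => k _; rewrite addr_ge0 // mulr_ge0 // forestc_ge0.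
apply: ler_sum => k _.
have -> : forestc p q (K + d) (N * K) (0 + k) (fun n => g (0 + n)%N) =
  forestc p q (K + d) (N * K) k g by [].
have -> : forestc p q (K + d) (N * K) (0 + k) (fun n => g (true + n)%N) =
  s * forestc p q (K + d) (N * K) k g.
  by rewrite -forestcZ; congr forestc; apply/funext => n; rewrite /g exprS.
rewrite mulrA -mulrDl [X in _ <= X * _](_ : _ = step_gf s k); last first.
  by rewrite /type_weight /step_gf; ring.
have c0 : 0 <= step_gf s k.
  rewrite mulr_ge0 //; have /andP[q0 q1] := q01 k.
  by rewrite addr_ge0 ?mulr_ge0 // subr_ge0.
rewrite ler_wpM2l //; apply: le_trans (@forestc_pow (K + d) N k g _ _ _) _ => //.
  by move=> a b; rewrite /g exprD.
by apply: ler_forestcN => //; rewrite leq_mul2l (ltnW (ltn_ord k)) orbT.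
Qed.

Lemma forestc_gf_bounded (s C : R) : 1 <= s ->
  (forall N, forestc p q N N 1 (fun n => s ^+ n) <= C) ->
  s = 1 /\ (fun N => forestc p q N N 1 (fun n => s ^+ n)) @ \oo --> (1 : R).
Proof.
move=> s1 YC; set Y := fun N => forestc p q N N 1 (fun n => s ^+ n).
have s0 : 0 <= s by apply: le_trans s1.
have Y_nd : nondecreasing_seq Y.
  move=> N N' NN'; rewrite /Y /= (@forestc_cutoff _ _ _ N N') //.
  by apply: ler_forestcN => // n; rewrite exprn_ge0.
have Yc : cvgn Y.
  by apply: nondecreasing_is_cvgn => //; exists C => _ [N _ <-]; exact: YC.
have Yle N : Y N <= limn Y by exact: nondecreasing_cvgn_le.
have [] := @step_gf_fixpoint s (limn Y) s1.
- by apply: le_trans (Yle 0%N); rewrite /Y forestc0S.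
- move=> K.
  have sc : (fun N => \sum_(k < K) step_gf s k * Y N ^+ k) @ \oo -->
      \sum_(k < K) step_gf s k * limn Y ^+ k.
    elim: K => [|K IH].
      by under eq_fun do rewrite big_ord0; rewrite big_ord0; exact: cvg_cst.
    under eq_fun do rewrite big_ord_recr /=.
    rewrite big_ord_recr /=; apply: (cvgD IH (cvgM (cvg_cst _) _)).
    exact: (continuous_cvg _ (@exprn_continuous R K (limn Y)) Yc).
  apply: (cvgr_to_le sc); exists 0%N => // N _ /=.
  case: K {sc} => [|K]; first by rewrite big_ord0; apply: le_trans (Yle 0%N); rewrite /Y forestc0S.
  set M := (N * K.+1).+1.
  have NM : (N <= M)%N by rewrite /M; nia.
  apply: le_trans (Yle M).
  have := @forestc_step_gf s K.+1 N M s0.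
  rewrite (@forestc_cutoff _ _ _ (K.+1 + M) N N) ?(@forestc_cutoff _ _ _ (K.+1 + M) M M) //; lia.
by move=> -> <-.
Qed.

Lemma forestc_total_cvg : (fun N => forestc p q N N 1 (fun=> 1)) @ \oo --> (1 : R).
Proof.
have [|_] := @forestc_gf_bounded 1 1 (lexx _).
  by move=> N; apply: forestc_le1 => // [k|n]; [exact: pmf_partial_le1|rewrite expr1n ler01 lexx].
by apply: cvg_trans; apply: near_eq_cvg; near=> N; congr forestc; apply/funext => n; rewrite expr1n.
Unshelve. all: by end_near. Qed.

End Critical.

(** * The ratio limit property *)

Section Geometric.
Context {R : realType}.

Lemma geometric_sum_le (x : R) N : 0 <= x < 1 ->
  \sum_(m < N) x ^+ m <= (1 - x)^-1.
Proof.
move=> /andP[x0 x1]; have x1' : 0 < 1 - x by rewrite subr_gt0.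
rewrite -(ler_pM2l x1') divff ?gt_eqF // -[1 - x]opprB mulNr -subrX1 opprB.
by rewrite gerBl exprn_ge0.
Qed.

Lemma geometric_tail_le (x : R) n0 L : 0 <= x < 1 ->
  \sum_(N < L) (n0 <= N.+1)%N%:R * x ^+ N.+1 <= x ^+ n0 / (1 - x).
Proof.
move=> /andP[x0 x1]; have x1' : 0 < 1 - x by rewrite subr_gt0.
rewrite ler_pdivlMr //.
suff H : (\sum_(N < L) (n0 <= N.+1)%N%:R * x ^+ N.+1) * (1 - x) <=
    x ^+ n0 - x ^+ maxn n0 L.+1.
  by apply: le_trans H _; rewrite gerBl exprn_ge0.
elim: L => [|L IH].
  rewrite big_ord0 mul0r subr_ge0; case: n0 => [|n0].
    by rewrite max0n expr1 expr0 ltW.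
  by rewrite maxnSS maxn0.
rewrite big_ord_recr mulrDl /=; case: leqP => [nL|Ln].
  have IH' := IH; rewrite (maxn_idPr nL) in IH'; rewrite mul1r.
  rewrite (maxn_idPr (leqW nL)); apply: le_trans (lerD IH' (lexx _)) _.
  by rewrite [x ^+ L.+2]exprSr le_eqVlt; apply/orP; left; apply/eqP; ring.
move: IH; rewrite !mul0r addr0 (maxn_idPl (ltnW Ln)).
by rewrite (maxn_idPl Ln).
Qed.

End Geometric.

Section ForestLimit.
Context {R : realType} (p q : nat -> R).
Hypothesis p_pmf : is_pmf p.
Hypothesis p0 : 0 < p 0%N.
Hypothesis p01 : p 0%N + p 1%N < 1.
Hypothesis p_critical : mean p = 1%E.
Hypothesis q01 : forall k, 0 <= q k <= 1.
Hypothesis pq : exists k, 0 < p k * q k.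

Let p_ge0 : forall k, 0 <= p k. Proof. by case: p_pmf. Qed.
Let p_le1 := pmf_partial_le1 p_pmf.
Let tw_ge0 := type_weight_ge0 p_ge0 q01.
Local Notation tw := (type_weight p q).
Local Notation fc := (forestc p q).

Definition forest_lim (j : nat) (g : nat -> R) : R := limn (fun N => fc N N j g).

Lemma forest_lim_cvg j g : (forall n, 0 <= g n <= 1) ->
  (fun N => fc N N j g) @ \oo --> forest_lim j g.
Proof.
move=> g01; apply: nondecreasing_is_cvgn.
  move=> N N' NN'; rewrite (@forestc_cutoff _ _ _ N N') //.
  by apply: ler_forestcN => // n; have /andP[] := g01 n.
by exists 1 => _ [N _ <-]; apply: forestc_le1.
Qed.

Arguments forest_lim_cvg j {g}.

Lemma forestc_le_lim N j g : (forall n, 0 <= g n <= 1) ->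
  fc N N j g <= forest_lim j g.
Proof.
move=> g01; apply: (@nondecreasing_cvgn_le _ (fun N => fc N N j g));
  last exact: cvgP (forest_lim_cvg j g01).
move=> M N' NN'; rewrite (@forestc_cutoff _ _ _ M N') //.
by apply: ler_forestcN => // n; have /andP[] := g01 n.
Qed.

Lemma forest_lim_ge0 j g : (forall n, 0 <= g n <= 1) -> 0 <= forest_lim j g.
Proof.
move=> g01; apply: le_trans (forestc_le_lim 0 j g01).
by apply: forestc_ge0 => // n; have /andP[] := g01 n.
Qed.

Lemma forest_lim_le1 j g : (forall n, 0 <= g n <= 1) -> forest_lim j g <= 1.
Proof.
move=> g01; apply: (cvgr_to_le (forest_lim_cvg j g01)).
by exists 0%N => // N _; apply: forestc_le1.
Qed.

Lemma forest_lim_supermul i j g1 g2 g : (forall n, 0 <= g1 n <= 1) ->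
  (forall n, 0 <= g2 n <= 1) -> (forall n, 0 <= g n <= 1) ->
  (forall a b, g1 a * g2 b <= g (a + b)%N) ->
  forest_lim i g1 * forest_lim j g2 <= forest_lim (i + j) g.
Proof.
move=> g10 g20 g0 gg.
apply: (cvgr_to_le (cvgM (forest_lim_cvg i g10) (forest_lim_cvg j g20))).
exists 0%N => // N _ /=; apply: le_trans (forestc_le_lim (N + N) _ g0).
rewrite !(@forestc_cutoff _ _ _ N (N + N) N) ?leq_addr //.
by apply: forestc_supermul => // n; [have /andP[] := g10 n|have /andP[] := g20 n].
Qed.

Lemma forest_lim_step j k z g : (forall n, 0 <= g n <= 1) ->
  tw k z * forest_lim (j + k) (fun n => g (z + n)%N) <= forest_lim j.+1 g.
Proof.
move=> g01; have g01' n : 0 <= g (z + n)%N <= 1 by apply: g01.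
apply: (cvgr_to_le (cvgM (cvg_cst (tw k z)) (forest_lim_cvg (j + k) g01'))).
exists 0%N => // N _ /=; apply: le_trans (forestc_le_lim (N + k.+1) _ g01).
apply: le_trans (_ : fc (N + k.+1) N.+1 j.+1 g <= _); last first.
  apply: ler_forestcN => //; last by move=> n; have /andP[] := g01 n.
  by rewrite addnS ltnS leq_addr.
rewrite forestcSS (@forestc_cutoff _ _ _ N (N + k.+1) N) ?leq_addr //.
have kK : (k < N + k.+1)%N by rewrite addnS ltnS leq_addl.
rewrite (bigD1 (Ordinal kK, z)) //= lerDl; apply: sumr_ge0 => t _.
by rewrite mulr_ge0 // forestc_ge0 // => n; have /andP[] := g01 (t.2 + n)%N.
Qed.

Definition mark_ind (m n x : nat) : R := (m + x == n)%N%:R.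

Lemma mark_ind01 m n x : 0 <= mark_ind m n x <= 1.
Proof. by rewrite /mark_ind; case: eqP => _; rewrite ?ler01 lexx. Qed.

Definition progeny_pmf n := forest_lim 1 (mark_ind 0 n).
Local Notation a := progeny_pmf.

Lemma progeny_pmf_ge0 n : 0 <= a n.
Proof. by apply: forest_lim_ge0; apply: mark_ind01. Qed.

Lemma progeny_pmf_grow m : 0 < a m ->
  exists (r : nat) (c : R), 0 < c /\ forall n j, c * a n * a j <= a (n + j + r)%N.
Proof.
move=> am; have [k pk] := exists_branching p_pmf p01.
have [z twz] : exists z, 0 < tw k.+2 z.
  have : 0 < tw k.+2 true + tw k.+2 false by rewrite type_weightD.
  case: (ltP 0 (tw k.+2 true)) => [|h]; first by exists true.
  by move=> h'; exists false; apply: lt_le_trans h' _; rewrite gerDr.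
exists (m * k + z)%N, (tw k.+2 z * a m ^+ k); split; first by rewrite mulr_gt0 ?exprn_gt0.
move=> n j.
have ind2 u v b c : mark_ind 0 u b * mark_ind 0 v c <= mark_ind 0 (u + v) (b + c).
  rewrite /mark_ind !add0n; case: eqP => [->|_]; last by rewrite mul0r.
  by case: eqP => [->|_]; rewrite ?mulr0 // eqxx mul1r.
have amk i : a m ^+ i <= forest_lim i (mark_ind 0 (m * i)).
  elim: i => [|i IH].
    apply: le_trans (forestc_le_lim 0 0 (mark_ind01 _ _)).
    by rewrite forestc0 /mark_ind muln0.
  rewrite exprS mulnS; apply: le_trans (ler_wpM2l (progeny_pmf_ge0 m) IH) _.
  by apply: forest_lim_supermul => //; apply: mark_ind01.
have -> : (n + j + (m * k + z))%N = (z + (n + (j + m * k)))%N by lia.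
apply: le_trans (@forest_lim_step 0 k.+2 z _ (mark_ind01 _ _)).
move: (tw k.+2 z) twz => t t0; rewrite -!mulrA ler_pM2l //.
have -> : (fun n0 => mark_ind 0 (z + (n + (j + m * k))) (z + n0)) =
    mark_ind 0 (n + (j + m * k)).
  by apply/funext => x; rewrite /mark_ind !add0n eqn_add2l.
rewrite mulrC -mulrA; apply: le_trans (_ : a n * forest_lim k.+1 (mark_ind 0 (j + m * k)) <= _).
  rewrite ler_wpM2l ?progeny_pmf_ge0 //.
  apply: le_trans (ler_wpM2l (progeny_pmf_ge0 j) (amk k)) _.
  by apply: (@forest_lim_supermul 1) => //; apply: mark_ind01.
by apply: (@forest_lim_supermul 1) => //; apply: mark_ind01.
Qed.

Lemma progeny_pmf_subexp_index (c : R) r (x : R) : 0 < c -> 0 < x < 1 ->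
  exists2 j, (0 < j)%N & x ^+ (j + r) <= c * a j.
Proof.
move=> c0 /andP[x0 x1]; apply: contrapT => H.
have {}H j : (0 < j)%N -> c * a j < x ^+ j.
  move=> j0; apply: lt_le_trans (_ : x ^+ (j + r) <= _).
    by rewrite ltNge; apply/negP => h; apply: H; exists j.
  by rewrite exprD ler_piMr ?exprn_ge0 ?exprn_ile1 ?ltW.
pose s := (1 + x^-1) / 2.
have xi : x * x^-1 = 1 by rewrite divff // gt_eqF.
have x1i : 1 < x^-1 by rewrite invf_gt1.
have s1 : 1 < s by rewrite /s; lra.
pose y := s * x.
have y1 : y < 1 by rewrite /y /s; nra.
have y0 : 0 < y by rewrite mulr_gt0 // (lt_trans _ s1).
have yE : y = s * x by [].
clearbody y s.
have [|s1' _] := @forestc_gf_bounded _ _ _ p_pmf p0 p01 p_critical q01 pq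
    s ((1 + c^-1) * (1 - y)^-1) (ltW s1).
  move=> N; rewrite forestc_expand.
  apply: le_trans (_ : \sum_(m < N.+1) (1 + c^-1) * y ^+ m <= _).
    apply: ler_sum => m _; rewrite yE exprMn mulrCA ler_wpM2l ?exprn_ge0 ?(le_trans _ (ltW s1)) //.
    apply: le_trans (_ : a m <= _).
      have -> : (fun n => ((m : nat) == n)%:R : R) = mark_ind 0 m.
        by apply/funext => n; rewrite /mark_ind add0n eq_sym.
      exact/forestc_le_lim/mark_ind01.
    have ci : 0 < c^-1 by rewrite invr_gt0.
    case: (posnP m) => [->|m0].
      rewrite expr0 mulr1; apply: le_trans (forest_lim_le1 _ (mark_ind01 _ _)) _.
      by rewrite lerDl ltW.
    rewrite mulrDl mul1r -[X in X <= _]add0r lerD ?exprn_ge0 ?(ltW x0) //.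
    by rewrite mulrC ler_pdivlMr // mulrC ltW // H.
  rewrite -mulr_sumr ler_wpM2l ?addr_ge0 ?invr_ge0 ?(ltW c0) //.
  by apply: geometric_sum_le; rewrite y1 ltW.
by move: s1; rewrite s1' ltxx.
Qed.

(* [a (n + J) >= x ^ J a n] for a single period [J] is enough: each residue
   class mod [J] meeting the support has a least element. *)
Lemma progeny_pmf_subexp (x : R) : 0 < x < 1 ->
  exists2 c : R, 0 < c & forall n, 0 < a n -> c * x ^+ n <= a n.
Proof.
move=> x01; have /andP[x0 x1] := x01.
case: (pselect (exists m, 0 < a m)) => [[m am]|H]; last first.
  by exists 1 => // n an; case: H; exists n.
have [r [c [c0 grow]]] := progeny_pmf_grow am.
have [j j0 xj] := progeny_pmf_subexp_index r c0 x01.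
pose J := (j + r)%N.
have J0 : (0 < J)%N by rewrite addn_gt0 j0.
have aJ n : x ^+ J * a n <= a (n + J)%N.
  rewrite addnA; apply: le_trans (grow n j).
  by rewrite mulrAC ler_wpM2r ?progeny_pmf_ge0.
clearbody J.
have aJl n l : x ^+ (l * J) * a n <= a (n + l * J)%N.
  elim: l => [|l IH]; first by rewrite mul0n expr0 mul1r addn0.
  have -> : (n + l.+1 * J = n + l * J + J)%N by rewrite mulSn addnA addnAC.
  apply: le_trans (aJ _); rewrite mulSn.
  by rewrite exprD -mulrA ler_wpM2l // exprn_ge0 // ltW.
have cls i : exists2 c : R, 0 < c &
    forall l, 0 < a (i + l * J)%N -> c * x ^+ (i + l * J) <= a (i + l * J)%N.
  case: (pselect (exists l, 0 < a (i + l * J)%N)) => [ex|H]; last first.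
    by exists 1 => // l al; case: H; exists l.
  case: (ex_minnP ex) => l0 al0 min.
  exists (a (i + l0 * J)%N) => // l /min ll.
  have -> : (i + l * J = i + l0 * J + (l - l0) * J)%N.
    by rewrite -addnA -mulnDl subnKC.
  apply: le_trans (aJl _ _); rewrite mulrC ler_pM2r // [x ^+ (_ + (l - l0) * J)]exprD.
  by rewrite ler_piMl ?exprn_ge0 ?exprn_ile1 // ltW.
have clsI I : exists2 C : R, 0 < C & forall i, (i < I)%N ->
    forall l, 0 < a (i + l * J)%N -> C * x ^+ (i + l * J) <= a (i + l * J)%N.
  elim: I => [|I [C C0 IH]]; first by exists 1.
  have [D D0 HD] := cls I.
  exists (Num.min C D); first by rewrite lt_min C0.
  move=> i; rewrite ltnS leq_eqVlt => /predU1P[->|iI] l al.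
    apply: le_trans (HD _ al); rewrite ler_wpM2r ?exprn_ge0 ?(ltW x0) //.
    by rewrite ge_min lexx orbT.
  apply: le_trans (IH _ iI _ al); rewrite ler_wpM2r ?exprn_ge0 ?(ltW x0) //.
  by rewrite ge_min lexx.
have [C C0 HC] := clsI J.
exists C => // n an; have nE := divn_eq n J; rewrite addnC in nE.
by rewrite nE; apply: HC; rewrite ?ltn_mod // -nE.
Qed.

Lemma forest_lim_neveu i k z e g n0 : 0 < e < tw k z -> (0 < i + k)%N ->
  (forall n, 0 <= g n <= 1) -> (forall n, (n < n0)%N -> g n = 0) ->
  (tw k z - e) * (forest_lim i.+1 g / i.+1%:R -
     chernoff_rate (tw k z) e ^+ n0 / (1 - chernoff_rate (tw k z) e)) <=
  tw k z * (forest_lim (i + k) (fun n => g (z + n)%N) / (i + k)%:R).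
Proof.
move=> eP ik g01 gn0; set rho := chernoff_rate _ _; have /andP[e0 ec] := eP.
have g01' n : 0 <= g (z + n)%N <= 1 by apply: g01.
have g'0 n : 0 <= g (z + n)%N by have /andP[] := g01' n.
have r01 : 0 <= rho < 1.
  by rewrite ltW ?chernoff_rate_gt0 // chernoff_rate_lt1 // (lt_trans e0).
have c1 : (fun N => (tw k z - e) *
    (fc N N i.+1 g / i.+1%:R - rho ^+ n0 / (1 - rho))) @ \oo -->
    (tw k z - e) * (forest_lim i.+1 g / i.+1%:R - rho ^+ n0 / (1 - rho)).
  exact: (cvgM (cvg_cst _) (cvgB (cvgM (forest_lim_cvg _ g01) (cvg_cst _))
    (cvg_cst _))).
have c2 : (fun N => tw k z *
    (fc N N (i + k) (fun n => g (z + n)%N) / (i + k)%:R)) @ \oo -->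
    tw k z * (forest_lim (i + k) (fun n => g (z + n)%N) / (i + k)%:R).
  exact: (cvgM (cvg_cst _) (cvgM (forest_lim_cvg _ g01') (cvg_cst _))).
apply: (ler_cvg_to c1 c2); exists 0%N => // L _ /=.
pose K := (L + k.+1)%N.
have kK : (k < K)%N by rewrite /K; lia.
rewrite !(@forestc_cutoff _ _ _ L K L) ?leq_addr //.
apply: le_trans (_ : (tw k z - e) * \sum_(N < L) (forest p q K N.+1 i.+1 g / i.+1%:R -
   (n0 <= N.+1)%N%:R * rho ^+ N.+1) <= _).
  rewrite ler_pM2l ?subr_gt0 // sumrB lerB ?geometric_tail_le //.
  by rewrite -mulr_suml ler_wpM2r ?invr_ge0 // /forestc big_ord_recl add0r.
apply: le_trans (_ : tw k z * \sum_(N < L) (forest p q K N (i + k)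
    (fun n => g (z + n)%N) / (i + k)%:R) <= _); last first.
  rewrite ler_wpM2l // -mulr_suml ler_wpM2r ?invr_ge0 // /forestc big_ord_recr /=.
  by rewrite lerDl forest_ge0.
rewrite !mulr_sumr; apply: ler_sum => N _.
case: leqP => [n0N|Nn0].
  rewrite mul1r; exact: (@forest_neveu _ _ _ p_ge0 p_le1 q01 K N i (Ordinal kK) z e g).
have -> : forest p q K N.+1 i.+1 g = 0.
  rewrite (@eq_forest _ _ _ _ _ _ _ (fun n => 0 * g n)); last first.
    by move=> n nN; rewrite gn0 ?mul0r // (leq_ltn_trans nN).
  by rewrite forestZ mul0r.
by rewrite !mul0r subrr mulr0 mulr_ge0 // divr_ge0 // forest_ge0.
Qed.

(* As [n] grows, a forest of [j] trees with [n - m] marks is at least [j] times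
   as likely as a tree with [n] marks. *)
Definition ratio_lower (j m : nat) : Prop := forall e, 0 < e ->
  exists n0, forall n, (n0 <= n)%N -> 0 < a n ->
    (1 - e) * a n <= forest_lim j (mark_ind m n) / j%:R.

Lemma ratio_lower1 : ratio_lower 1 0.
Proof.
move=> e e0; exists 0%N => n _ an; rewrite invr1 mulr1 -/(a n) mulrBl mul1r.
by rewrite gerBl mulr_ge0 // ltW.
Qed.

Lemma ratio_lower_step i m k z : ratio_lower i.+1 m -> 0 < tw k z ->
  (0 < i + k)%N -> ratio_lower (i + k) (m + z).
Proof.
move=> rim c0 ik eps eps0; set c := tw k z in c0 *.
pose d := Num.min eps 1 / 3.
have m1 : 0 < Num.min eps 1 by rewrite lt_min eps0 ltr01.
have me : Num.min eps 1 <= eps by rewrite ge_min lexx.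
have me1 : Num.min eps 1 <= 1 by rewrite ge_min lexx orbT.
have d0 : 0 < d by rewrite /d; lra.
have d3 : 3 * d <= eps by rewrite /d; lra.
have d31 : 3 * d <= 1 by rewrite /d; lra.
pose e := c * d.
have eP : 0 < e < c by rewrite /e mulr_gt0 //= gtr_pMr //; lra.
have /andP[e0 ec] := eP.
pose rho := chernoff_rate c e.
have r0 : 0 < rho by apply: chernoff_rate_gt0.
have r1 : rho < 1 by apply: chernoff_rate_lt1.
pose x := (1 + rho) / 2.
have x01 : 0 < x < 1 by rewrite /x; apply/andP; split; lra.
have /andP[x0 x1] := x01.
have rx : rho < x by rewrite /x; lra.
clearbody x.
have [C C0 HC] := progeny_pmf_subexp x01.
pose D := (1 - rho)^-1.
have D0 : 0 < D by rewrite invr_gt0 subr_gt0.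
have [n0 Hn0] := rim d d0.
pose B := d * (C * x ^+ m) / D.
have B0 : 0 < B by rewrite divr_gt0 // !mulr_gt0 // exprn_gt0.
have [l1 Hl1] : exists l1, forall l, (l1 <= l)%N -> (rho / x) ^+ l <= B.
  have rx1 : `|rho / x| < 1.
    by rewrite ger0_norm ?divr_ge0 ?ltW // ltr_pdivrMr // mul1r.
  have /cvgrPdist_le/(_ B B0)[l1 _ H] := cvg_expr rx1.
  exists l1 => l /H /=; rewrite sub0r normrN ger0_norm // exprn_ge0 //.
  by rewrite divr_ge0 // ltW.
exists (maxn n0 (m + l1)) => n; rewrite geq_max => /andP[nn0 nml] an.
have mn : (m <= n)%N by apply: leq_trans nml; rewrite leq_addr.
have tail : rho ^+ (n - m) * D <= d * a n.
  apply: le_trans (ler_wpM2l (ltW d0) (HC _ an)).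
  rewrite -[n in x ^+ n](subnKC mn) exprD.
  have /Hl1 : (l1 <= n - m)%N by rewrite leq_subRL.
  rewrite expr_div_n ler_pdivrMr ?exprn_gt0 // /B => h.
  rewrite -ler_pdivlMr //; apply: le_trans h _.
  by rewrite le_eqVlt; apply/orP; left; apply/eqP; ring.
have := @forest_lim_neveu i k z e (mark_ind m n) (n - m) eP ik (mark_ind01 _ _).
rewrite -/c -/rho -/D.
have -> : (fun n1 => mark_ind m n (z + n1)) = mark_ind (m + z) n.
  by apply/funext => y; rewrite /mark_ind addnA.
set X := _ / (i + k)%:R; have := Hn0 n nn0 an; set Y := _ / _ => Y1 XY.
rewrite -(ler_pM2l c0); apply: le_trans (XY _); last first.
  by move=> y; rewrite /mark_ind ltn_subRL; case: eqP => // ->; rewrite ltnn.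
apply: (@le_trans _ _ ((c - e) * ((1 - d) * a n - d * a n))); last first.
  by rewrite ler_pM2l ?subr_gt0 // lerB.
have -> : (c - e) * ((1 - d) * a n - d * a n) = c * ((1 - d) * (1 - 2 * d) * a n).
  by rewrite /e; ring.
rewrite ler_pM2l // ler_pM2r //; nra.
Qed.

Lemma ratio_lower_seq (L : seq (nat * bool)) l m :
  all (fun t => 0 < tw t.1 t.2) L -> ratio_lower (size L + l) m ->
  (0 < l + \sum_(t <- L) t.1)%N ->
  ratio_lower (l + \sum_(t <- L) t.1) (m + \sum_(t <- L) t.2).
Proof.
elim: L l m => [|[k z] L IH] l m /=; first by rewrite !big_nil !addn0 add0n.
move=> /andP[kz HL] rl; rewrite !big_cons /= !addnA => h.
apply: IH => //; rewrite addnA; apply: ratio_lower_step => //.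
by case: (L) h => [|? ?] //=; rewrite big_nil addn0 add0n.
Qed.

End ForestLimit.

(** * Events and finite partitions *)

Section CountableEvents.
Context d (T : measurableType d).

Lemma measurable_forall (J : countType) (F : J -> set T) :
  (forall i, measurable (F i)) -> measurable [set w | forall i, F i w].
Proof.
move=> mF; have -> : [set w | forall i, F i w] =
    \bigcap_n (if choice.unpickle n is Some i then F i else setT).
  apply/seteqP; split=> w /= H; first by move=> n _; case: (choice.unpickle n).
  by move=> i; have := H (choice.pickle i) I; rewrite choice.pickleK.
by apply: bigcapT_measurable => n; case: (choice.unpickle n) => // i; exact: mF.
Qed.

Lemma measurable_exists (J : countType) (F : J -> set T) :
  (forall i, measurable (F i)) -> measurable [set w | exists i, F i w].
Proof.
move=> mF; have -> : [set w | exists i, F i w] = ~` [set w | forall i, (~` F i) w].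
  apply/seteqP; split=> w /=; first by move=> [i Fi] H; exact: (H i).
  by move=> /existsNP[i /contrapT Fi]; exists i.
by apply/measurableC/measurable_forall => i; apply: measurableC.
Qed.

Lemma measurable_imply_prop (A : Prop) (F : set T) :
  measurable F -> measurable [set w | A -> F w].
Proof.
move=> mF; have [a|na] := pselect A.
  by rewrite (_ : [set _ | _] = F) //; apply/seteqP; split=> w //= /(_ a).
by rewrite (_ : [set _ | _] = setT) //; apply/seteqP; split=> w // _ /na.
Qed.

Lemma measurable_and_prop (A : Prop) (F : set T) :
  measurable F -> measurable [set w | A /\ F w].
Proof.
move=> mF; have [a|na] := pselect A.
  by rewrite (_ : [set _ | _] = F) //; apply/seteqP; split=> w // [].
by rewrite (_ : [set _ | _] = set0) //; apply/seteqP; split=> w // [].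
Qed.

Lemma measurable_iff_prop (A : Prop) (F : set T) :
  measurable F -> measurable [set w | F w <-> A].
Proof.
move=> mF; have [a|na] := pselect A.
  by rewrite (_ : [set _ | _] = F) //; apply/seteqP; split=> w /= => [[_ /(_ a)]|].
rewrite (_ : [set _ | _] = ~` F); first exact: measurableC.
by apply/seteqP; split=> w /=; [move=> [FA _] /FA /na|move=> nF; split].
Qed.

End CountableEvents.

Section RealProbability.
Context {R : realType} d (T : measurableType d) (P : probability T R).

Lemma prE A : measurable A -> P A = (fine (P A))%:E.
Proof. by move=> mA; rewrite fineK // fin_num_measure. Qed.

Lemma pr_ge0 A : 0 <= fine (P A).
Proof. exact: fine_ge0. Qed.

Lemma pr_set0 : fine (P set0) = 0.
Proof. by rewrite measure0. Qed.

Lemma pr_setT : fine (P setT) = 1.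
Proof. by rewrite probability_setT. Qed.

Lemma ler_pr A B : measurable A -> measurable B -> A `<=` B ->
  fine (P A) <= fine (P B).
Proof. by move=> mA mB AB; rewrite -lee_fin -!prE // le_measure // inE. Qed.

Lemma pr_le1 A : measurable A -> fine (P A) <= 1.
Proof. by move=> mA; rewrite -pr_setT ler_pr. Qed.

Lemma pr_setU A B : measurable A -> measurable B -> [disjoint A & B] ->
  fine (P (A `|` B)) = fine (P A) + fine (P B).
Proof.
move=> mA mB /disj_setPS AB; apply/EFin_inj; rewrite EFinD -!prE //.
  by rewrite measureU //; apply/seteqP; split.
exact: measurableU.
Qed.

Lemma pr_splitC A B : measurable A -> measurable B ->
  fine (P A) = fine (P (A `&` B)) + fine (P (A `&` ~` B)).
Proof.
move=> mA mB; rewrite -pr_setU; last 1 first.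
- by apply/disj_setPS => w [[_ Bw] [_ /(_ Bw)]].
- by rewrite -setIUr setUv setIT.
- exact: measurableI.
- by apply: measurableI => //; exact: measurableC.
Qed.

Lemma pr_setC A : measurable A -> fine (P (~` A)) = 1 - fine (P A).
Proof.
move=> mA; rewrite -pr_setT (pr_splitC measurableT mA) !setTI.
by rewrite addrAC subrr add0r.
Qed.

Lemma pr_partition (V : finType) (c : T -> V) X :
  (forall t, measurable [set w | c w = t]) -> measurable X ->
  fine (P X) = \sum_t fine (P (X `&` [set w | c w = t])).
Proof.
move=> mc mX.
have H (s : seq V) : uniq s -> measurable [set w | c w \in s] /\
    fine (P (X `&` [set w | c w \in s])) =
    \sum_(t <- s) fine (P (X `&` [set w | c w = t])).
  elim: s => [_|t s IH /= /andP[ts us]].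
    have -> : [set w | c w \in [::]] = set0 by apply/seteqP; split.
    by rewrite setI0 pr_set0 big_nil.
  have [ms IHe] := IH us.
  have -> : [set w | c w \in t :: s] = [set w | c w = t] `|` [set w | c w \in s].
    apply/seteqP; split=> w /=; rewrite inE.
      by move=> /predU1P.
    by move=> h; apply/predU1P.
  split; first exact: measurableU.
  rewrite setIUr pr_setU ?big_cons ?IHe //; try exact: measurableI.
  by apply/disj_setPS => w [[_ /= ->] [_ /=]]; rewrite (negPf ts).
have [_] := H _ (enum_uniq V).
rewrite -big_enum => <-; congr (fine (P _)).
by apply/seteqP; split=> [w Xw|w []//]; split=> //=; rewrite mem_enum.
Qed.

Lemma pr_wordsum (V : finType) I (c : I -> T -> V) (L : seq I) X :
  (forall i t, measurable [set w | c i w = t]) -> measurable X ->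
  fine (P X) = wordsum (fun=> 1) (size L)
    (fun x => fine (P (X `&` [set w | [seq c i w | i <- L] = x]))).
Proof.
move=> mc; elim: L X => [|i L IH] X mX /=.
  by congr (fine (P _)); apply/seteqP; split=> [w|w []].
rewrite (pr_partition (mc i) mX); apply: eq_bigr => t _; rewrite mul1r.
rewrite IH; last exact: measurableI.
apply: eq_wordsum => x _; congr (fine (P _)); apply/seteqP; split=> w /=.
  by move=> [[Xw <-] <-].
by move=> [Xw [<- <-]].
Qed.

Lemma pr_negligible_exists (J : countType) (F : J -> set T) :
  (forall i, measurable (F i)) -> (forall i, P (F i) = 0%E) ->
  P [set w | exists i, F i w] = 0%E.
Proof.
move=> mF PF; have -> : [set w | exists i, F i w] =
    \bigcup_n (if choice.unpickle n is Some i then F i else set0).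
  apply/seteqP; split=> w /=.
    by move=> [i Fi]; exists (choice.pickle i) => //; rewrite choice.pickleK.
  by move=> [n _]; case: (choice.unpickle n) => // i Fi; exists i.
apply/negligibleP.
  by apply: bigcupT_measurable => n; case: (choice.unpickle n).
apply: negligible_bigcup => n; case: (choice.unpickle n) => [i|]; last exact: negligible_set0.
exact/(negligibleP _ (mF i))/PF.
Qed.

End RealProbability.

(** * Trees *)

Section Trees.

Lemma outdeg_mem (t : tree) u : t u -> outdeg t u = (nb_children t u)%:Z.
Proof. by move=> tu; rewrite /outdeg asboolT. Qed.

Lemma outdeg_eqP (t : tree) u (k : nat) :
  outdeg t u = k%:Z <-> t u /\ nb_children t u = k.
Proof.
split=> [|[tu <-]]; last exact: outdeg_mem.
by rewrite /outdeg; case: asboolP => // tu [].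
Qed.

Lemma tree_rconsP (t : tree) u i :
  t (rcons u i) <-> t u /\ (0 < i <= nb_children t u)%N.
Proof.
split=> [tui|[tu /andP[i0 ik]]]; last by apply/nb_childrenP.
have tu : t u by apply: (@tree_prefix t u [:: i]); rewrite cats1.
have i0 : (0 < i)%N by have := tree_letters tui; rewrite all_rcons => /andP[].
by rewrite i0; split=> //; apply/nb_childrenP.
Qed.

Lemma eq_nb_children (s t : tree) u v : s u -> t v ->
  (forall i, s (rcons u i) <-> t (rcons v i)) ->
  nb_children s u = nb_children t v.
Proof.
move=> su tv st; apply/eqP; rewrite eqn_leq; apply/andP; split.
  case E : (nb_children s u) => [//|k]; have : s (rcons u k.+1).
    by apply/tree_rconsP; rewrite E ltn0Sn leqnn.
  by move=> /st /tree_rconsP[_ /andP[]].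
case E : (nb_children t v) => [//|k]; have : t (rcons v k.+1).
  by apply/tree_rconsP; rewrite E ltn0Sn leqnn.
by move=> /st /tree_rconsP[_ /andP[]].
Qed.

Lemma same_upto_sym h s t : same_upto h s t -> same_upto h t s.
Proof. by move=> st u /st; move=> [? ?]; split. Qed.

Lemma same_upto_trans h r s t :
  same_upto h r s -> same_upto h s t -> same_upto h r t.
Proof. by move=> rs st u uh; rewrite (rs u uh); exact: st. Qed.

Lemma same_upto_le h h' s t : (h <= h')%N -> same_upto h' s t -> same_upto h s t.
Proof. by move=> hh st u uh; apply: st; apply: leq_trans hh. Qed.

Lemma same_upto0 s t : same_upto 0 s t.
Proof. by move=> u; rewrite leqn0 size_eq0 => /eqP ->; split=> _; apply: tree_root. Qed.

Lemma same_upto_nb_children h s t u : same_upto h s t -> (size u < h)%N ->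
  t u -> nb_children s u = nb_children t u.
Proof.
move=> st uh tu; apply: eq_nb_children => //; first by apply/st => //; exact: ltnW.
by move=> i; apply: st; rewrite size_rcons.
Qed.

Lemma same_uptoS h s t : same_upto h.+1 s t <-> same_upto h s t /\
  forall u, generation t h u -> outdeg s u = (nb_children t u)%:Z.
Proof.
split=> [st|[st so]].
  split=> [|u [tu uh]]; first exact: same_upto_le st.
  apply/outdeg_eqP; split; first by apply/st; rewrite ?uh.
  by apply: same_upto_nb_children st _ tu; rewrite uh.
move=> u; rewrite leq_eqVlt ltnS => /predU1P[uh|/st //].
case/lastP: u uh => // u i; rewrite size_rcons => -[uh].
split=> /tree_rconsP[su ik]; apply/tree_rconsP.
  have tu : t u by apply/st; rewrite // uh.
  by split=> //; have /outdeg_eqP[_ <-] := so u (conj tu uh).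
by have /outdeg_eqP[? ->] := so u (conj su uh).
Qed.

Lemma finite_younger (t : tree) h : finite_set [set u | t u /\ (size u < h)%N].
Proof.
elim: h => [|h IH]; first by apply: (sub_finite_set _ (finite_set0 word)) => u [].
have : finite_set ([set u | t u /\ (size u < h)%N] `|` generation t h).
  by rewrite finite_setU; split=> //; exact: finite_generation.
apply: sub_finite_set => u [tu]; rewrite ltnS leq_eqVlt => /predU1P[|] ?.
  by right.
by left.
Qed.

Definition level (t : tree) h : {fset word} := fset_set (generation t h).
Definition younger (t : tree) h : {fset word} :=
  fset_set [set u | t u /\ (size u < h)%N].

Lemma in_level (t : tree) h u : reflect (t u /\ size u = h) (u \in level t h).
Proof.
rewrite /level in_fset_set; last exact: finite_generation.
by apply: (iffP idP); rewrite inE.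
Qed.

Lemma in_younger (t : tree) h u : reflect (t u /\ (size u < h)%N) (u \in younger t h).
Proof.
rewrite /younger in_fset_set; last exact: finite_younger.
by apply: (iffP idP); rewrite inE.
Qed.

Lemma younger0 t : younger t 0 = fset0.
Proof. by apply/fsetP => u; rewrite inE; apply/in_younger => -[]. Qed.

Lemma level0 t : level t 0 = [fset [::]]%fset.
Proof.
apply/fsetP => u; rewrite inE; apply/in_level/eqP => [[_ /size0nil] //|->].
by split=> //; exact: tree_root.
Qed.

Lemma younger_perm t h :
  perm_eq (younger t h.+1) (younger t h ++ level t h).
Proof.
apply: uniq_perm; rewrite ?fset_uniq // ?cat_uniq ?fset_uniq ?andbT /=.
  apply/hasPn => u /in_level[_ uh]; apply/negP => /in_younger[_].
  by rewrite uh ltnn.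
move=> u; rewrite mem_cat; apply/in_younger/orP.
  move=> [tu]; rewrite ltnS leq_eqVlt => /predU1P[uh|uh].
    by right; apply/in_level.
  by left; apply/in_younger.
by move=> [/in_younger|/in_level] [tu uh]; split=> //; [exact: ltnW|rewrite uh].
Qed.

Lemma level_perm t h : perm_eq (level t h.+1)
  [seq rcons u i | u <- level t h, i <- iota 1 (nb_children t u)].
Proof.
apply: uniq_perm; rewrite ?fset_uniq //.
  apply: allpairs_uniq_dep => [||[u i] [v j] _ _ /= /rcons_inj[-> ->] //].
    exact: fset_uniq.
  by move=> u _; exact: iota_uniq.
move=> u; apply/in_level/allpairsPdep => [[tu uh]|[v [i [vl il ->]]]].
  case/lastP: u tu uh => // u i /tree_rconsP[tu ik]; rewrite size_rcons => -[uh].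
  exists u, i; split=> //; first by apply/in_level.
  by rewrite mem_iota add1n ltnS.
move: vl il => /in_level[tv <-]; rewrite mem_iota add1n ltnS size_rcons => ?.
by split=> //; apply/tree_rconsP.
Qed.

Lemma size_level t h :
  size (level t h.+1) = (\sum_(u <- level t h) nb_children t u)%N.
Proof.
rewrite (perm_size (level_perm t h)) size_allpairs_dep sumnE big_map.
by apply: eq_bigr => u _; rewrite size_iota.
Qed.

Lemma same_upto_level h h' s t : same_upto h s t -> (h' <= h)%N ->
  level s h' = level t h'.
Proof.
move=> st hh; apply/fsetP => u; apply/in_level/in_level => -[tu uh];
by split=> //; apply/st; rewrite ?uh.
Qed.

Lemma same_upto_younger h h' s t : same_upto h s t -> (h' <= h.+1)%N ->
  younger s h' = younger t h'.
Proof.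
move=> st hh; apply/fsetP => u; apply/in_younger/in_younger => -[tu uh];
by split=> //; apply/st => //; rewrite -ltnS; apply: leq_trans hh.
Qed.

Lemma outdegs_continuous u :
  continuous (fun s : tree => outdegs s u : discrete_topology int).
Proof.
move=> s; have c1 := @initial_continuous _ _ outdegs s.
have c2 := @proj_continuous _ (fun=> discrete_topology int) u (outdegs s).
exact: (cvg_comp _ _ c1 c2).
Qed.

Lemma measurable_outdeg u (k : int) : measurable [set t : tree | outdeg t u = k].
Proof.
apply: sub_sigma_algebra.
have /continuousP/(_ [set k]) := outdegs_continuous (u := u).
by apply; exact: discrete_open.
Qed.

Lemma measurable_tree_mem u : measurable [set t : tree | t u].
Proof.
rewrite (_ : [set _ | _] = ~` [set t : tree | outdeg t u = -1]).
  by apply: measurableC; exact: measurable_outdeg.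
by apply/seteqP; split=> t /=; rewrite /outdeg; case: asboolP => // ?; case: nb_children.
Qed.

Lemma nb_children_out (t : tree) u : ~ t u -> nb_children t u = 0%N.
Proof.
move=> ntu; rewrite /nb_children; case: xgetP => // -[//|k] _ /= H.
have : t (rcons u k.+1) by apply/H.
by case/tree_rconsP.
Qed.

Lemma measurable_nb_children u (B : nat -> Prop) :
  measurable [set t : tree | B (nb_children t u)].
Proof.
rewrite (_ : [set t : tree | _] = [set t : tree | exists k, B k /\ nb_children t u = k]);
  last by apply/seteqP; split=> t /=; [exists (nb_children t u)|move=> [k [Bk ->]]].
apply: (measurable_exists (F := fun k => [set t : tree | B k /\ nb_children t u = k])) => k.
apply: (measurable_and_prop _ (F := [set t : tree | nb_children t u = k])).
case: k => [|k].
  rewrite (_ : [set _ | _] = [set t : tree | outdeg t u = 0] `|` ~` [set t : tree | t u]).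
    apply: measurableU; first exact: measurable_outdeg.
    by apply: measurableC; exact: measurable_tree_mem.
  apply/seteqP; split=> t /=; last by move=> [/outdeg_eqP[]|/nb_children_out].
  move=> nb0; have [tu|ntu] := pselect (t u); last by right.
  by left; apply/outdeg_eqP.
rewrite (_ : [set _ | _] = [set t : tree | outdeg t u = k.+1]).
  exact: measurable_outdeg.
apply/seteqP; split=> t /=; last by move=> /outdeg_eqP[].
move=> nb; apply/outdeg_eqP; split=> //; apply: contrapT => /nb_children_out.
by rewrite nb.
Qed.

Lemma measurable_same_upto h (t : tree) : measurable [set s : tree | same_upto h s t].
Proof.
apply: (measurable_forall (F := fun u => [set s : tree | (size u <= h)%N -> (s u <-> t u)])) => u.
apply: measurable_imply_prop; apply: (measurable_iff_prop (t u)).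
exact: measurable_tree_mem.
Qed.

End Trees.

(** * Marked Galton-Watson trees *)

Section Exploration.
Context {R : realType} (p q : nat -> R).

Lemma forestc_gt K N j g : (N < j)%N -> forestc p q K N j g = 0.
Proof.
move=> Nj; rewrite /forestc big1 // => i _; apply: forest_gt.
by rewrite (leq_trans _ Nj) // ltnS -ltnS.
Qed.

Lemma forestc_explore K N i l g : forestc p q K (N + i) (l + i) g =
  wordsum (fun t : 'I_K * bool => type_weight p q t.1 t.2) i
    (fun x => forestc p q K N (l + degsum x) (fun n => g (marksum x + n)%N)).
Proof.
elim: i l g => [|i IH] l g.
  by rewrite /= /degsum /marksum !big_nil !addn0.
rewrite !addnS forestcSS /=; apply: eq_bigr => t _; congr (_ * _).
rewrite addnAC IH; apply: eq_wordsum => x _; rewrite /degsum /marksum !big_cons.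
by rewrite addnA; congr forestc; apply/funext => n; rewrite addnA.
Qed.

Lemma wordsum_weight (T : finType) (w : T -> R) N f :
  wordsum w N f = wordsum (fun=> 1) N (fun x => (\prod_(t <- x) w t) * f x).
Proof.
elim: N f => [|N IH] f /=; first by rewrite big_nil mul1r.
apply: eq_bigr => t _; rewrite mul1r IH -wordsumZ; apply: eq_wordsum => x _.
by rewrite big_cons mulrA.
Qed.

Lemma map_nth_index (T : eqType) (V : Type) (v0 : V) (L : seq T) (x : seq V) :
  uniq L -> size x = size L -> [seq nth v0 x (index u L) | u <- L] = x.
Proof.
move=> uL sx; case: L uL sx => [|u0 L] uL sx; first by case: x sx.
apply: (@eq_from_nth _ v0); first by rewrite size_map.
move=> i; rewrite size_map => iL.
by rewrite (nth_map u0) // index_uniq.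
Qed.

End Exploration.

Section GaltonWatson.
Context {R : realType} (p q : nat -> R).
Hypothesis p_pmf : is_pmf p.
Hypothesis q01 : forall k, 0 <= q k <= 1.
Context d (Om : measurableType d) (P : probability Om R).
Context (tau : {RV P >-> tree}) (M : Om -> set word).
Hypothesis tauM : is_marked_GW p q tau M.

Local Notation pr A := (fine (P A)).
Local Notation tw := (type_weight p q).

Lemma measurable_cylinder d' (Om' : measurableType d') (s : {mfun Om' >-> tree}) h t :
  measurable [set w | same_upto h (s w) t].
Proof. exact: (measurable_funPTI s (measurable_same_upto h t)). Qed.

Lemma measurable_level_outdeg d' (Om' : measurableType d')
    (s : {mfun Om' >-> tree}) h (t : tree) (n : word -> nat) :
  measurable [set w | forall u, generation t h u -> outdeg (s w) u = (n u)%:Z].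
Proof.
apply: (measurable_forall (F := fun u => [set w | generation t h u ->
  outdeg (s w) u = (n u)%:Z])) => u.
apply: measurable_imply_prop; exact: (measurable_funPTI s (measurable_outdeg u _)).
Qed.

Lemma cond_prob_mul A B (x : R) : measurable A -> measurable B ->
  ((0 < P B)%E -> cond_prob P A B = x) -> pr (A `&` B) = pr B * x.
Proof.
move=> mA mB H; have := pr_ge0 P B; rewrite le_eqVlt => /predU1P[B0|B0].
  rewrite -B0 mul0r; apply/eqP; rewrite eq_le pr_ge0 andbT B0.
  by apply: ler_pr => //; exact: measurableI.
rewrite -H; last by rewrite (prE P mB) lte_fin.
by rewrite /cond_prob mulrC mulfVK // gt_eqF.
Qed.

Lemma GW_level h t (n : word -> nat) :
  pr ([set w | forall u, generation t h u -> outdeg (tau w) u = (n u)%:Z] `&`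
      [set w | same_upto h (tau w) t]) =
  pr [set w | same_upto h (tau w) t] * \prod_(u <- level t h) p (n u).
Proof.
have [GW _ _] := tauM.
apply: cond_prob_mul.
- exact: measurable_level_outdeg.
- exact: measurable_cylinder.
- by move=> /GW ->; rewrite fsbig_finite //; exact: finite_generation.
Qed.

Definition cylinder_weight (t : tree) h : R :=
  \prod_(u <- younger t h) p (nb_children t u).

Lemma GW_cylinder h t :
  pr [set w | same_upto h (tau w) t] = cylinder_weight t h.
Proof.
elim: h => [|h IH].
  rewrite /cylinder_weight younger0 big_seq_fset0 (_ : [set _ | _] = setT) ?pr_setT //.
  by apply/seteqP; split=> w // _; exact: same_upto0.
rewrite (_ : [set _ | _] = [set w | forall u, generation t h u ->
    outdeg (tau w) u = (nb_children t u)%:Z] `&` [set w | same_upto h (tau w) t]).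
  by rewrite GW_level IH /cylinder_weight (perm_big _ (younger_perm t h)) big_cat.
by apply/seteqP; split=> w /=; [move=> /same_uptoS[]|move=> [? ?]; apply/same_uptoS].
Qed.

Definition marked_cylinder (t : tree) (S : word -> bool) h : set Om :=
  [set w | same_upto h (tau w) t] `&`
  [set w | forall u, u \in younger t h -> (M w u <-> S u)].

Definition marked_weight (t : tree) (S : word -> bool) h : R :=
  \prod_(u <- younger t h) tw (nb_children t u) (S u).

Lemma measurable_marked_cylinder t S h : measurable (marked_cylinder t S h).
Proof.
have [_ mM _] := tauM; apply: measurableI; first exact: measurable_cylinder.
apply: (measurable_forall (F := fun u => [set w | u \in younger t h ->
  (M w u <-> S u)])) => u.
by apply: measurable_imply_prop; apply: measurable_iff_prop; exact: mM.
Qed.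

Lemma pr_marked_cylinder t S h :
  pr (marked_cylinder t S h) = marked_weight t S h.
Proof.
have [_ mM HM] := tauM.
have mA := measurable_same_upto h t.
have := HM _ (younger t h) S mA; rewrite /marked_cylinder => ->.
rewrite (eq_integral (fun=> (\prod_(u <- younger t h)
   (if S u then q (nb_children t u) else 1 - q (nb_children t u)))%:E)); last first.
  move=> w; rewrite inE /= => wt; congr (_%:E); rewrite /marks_pmf.
  apply: eq_big_seq => u /in_younger[tu uh].
  rewrite /bernoulli_pmf /mark_prob asboolT; last by apply/wt => //; exact: ltnW.
  by rewrite (same_upto_nb_children wt uh tu).
rewrite integral_cst; last exact: measurable_cylinder.
rewrite [X in (_ * X)%E](prE P (measurable_funPTI tau mA)) -EFinM [LHS]/=.
rewrite [X in _ * X](GW_cylinder h t) mulrC.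
by rewrite /cylinder_weight /marked_weight -big_split.
Qed.

Definition unmarkable : set Om := [set w | exists u, M w u /\ ~ tau w u].

Lemma measurable_unmarkable : measurable unmarkable.
Proof.
have [_ mM _] := tauM.
apply: (measurable_exists (F := fun u => [set w | M w u /\ ~ tau w u])) => u.
apply: (measurableI _ _ (mM u)).
apply: (measurable_funPTI tau (Y := ~` [set s : tree | s u])).
by apply: measurableC; exact: measurable_tree_mem.
Qed.

Lemma unmarkable_negligible : pr unmarkable = 0.
Proof.
have [_ mM HM] := tauM.
have mF u : measurable [set w | M w u /\ ~ tau w u].
  apply: (measurableI _ _ (mM u)).
  apply: (measurable_funPTI tau (Y := ~` [set s : tree | s u])).
  by apply: measurableC; exact: measurable_tree_mem.
rewrite /unmarkable (pr_negligible_exists mF) // => u.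
have mA : measurable [set s : tree | ~ s u] by apply: measurableC; exact: measurable_tree_mem.
have := HM _ [fset u]%fset xpredT mA.
rewrite integral0_eq => [<-|w /= ntu]; last first.
  by rewrite /marks_pmf big_seq_fset1 /= /mark_prob asboolF.
congr (P _); apply/seteqP; split=> w /=.
  by move=> [Mu ntu]; split=> // v; rewrite inE => /eqP ->; split.
by move=> [ntu H]; split=> //; apply/H; rewrite ?inE.
Qed.

Lemma ler_pr_ae A B : measurable A -> measurable B ->
  A `&` ~` unmarkable `<=` B -> pr A <= pr B.
Proof.
move=> mA mB AB; have mN := measurable_unmarkable.
rewrite (pr_splitC P mA mN) -[X in _ <= X]add0r lerD //.
  rewrite -unmarkable_negligible; apply: ler_pr; first exact: measurableI.
    exact: mN.
  by move=> w [].
apply: ler_pr; [|exact: mB|exact: AB].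
by apply: measurableI => //; exact: measurableC.
Qed.

Definition progeny_le N : set Om :=
  [set w | exists F : {fset word}, (#|` F| <= N)%N /\ forall u, tau w u -> u \in F].

Definition mark_count n : set Om := [set w | (M w #= `I_n)%card].

Lemma measurable_progeny_le N : measurable (progeny_le N).
Proof.
apply: (measurable_exists (F := fun F : {fset word} =>
  [set w | (#|` F| <= N)%N /\ forall u, tau w u -> u \in F])) => F.
apply: (measurable_and_prop _ (F := [set w | forall u, tau w u -> u \in F])).
apply: (measurable_forall (F := fun u => [set w | tau w u -> u \in F])) => u.
apply: (measurable_funPTI tau (Y := [set s : tree | s u -> u \in F])).
have [uF|uF] := boolP (u \in F).
  by rewrite (_ : [set _ | _] = setT) //; apply/seteqP; split.
rewrite (_ : [set _ | _] = ~` [set s : tree | s u]); last first.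
  by apply/seteqP; split=> s /= H; [move=> /H; exact/negP|move=> /H].
by apply: measurableC; exact: measurable_tree_mem.
Qed.

Lemma mark_countP n w : mark_count n w <->
  exists F : {fset word}, #|` F| = n /\ forall u, M w u <-> u \in F.
Proof.
split=> [Mn|[F [<- MF]]].
  have fM : finite_set (M w) by apply/finite_setP; exists n.
  exists (fset_set (M w)); split; first exact: card_fset_set.
  by move=> u; rewrite in_fset_set //; split; rewrite inE.
rewrite /mark_count /= (_ : M w = [set` F]); first exact/card_eq_fsetP.
by apply/seteqP; split=> u /=; move/MF.
Qed.

Lemma measurable_mark_count n : measurable (mark_count n).
Proof.
have [_ mM _] := tauM.
rewrite (_ : mark_count n = [set w | exists F : {fset word},
  #|` F| = n /\ forall u, M w u <-> u \in F]); last first.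
  by apply/seteqP; split=> w /mark_countP.
apply: (measurable_exists (F := fun F : {fset word} =>
  [set w | #|` F| = n /\ forall u, M w u <-> u \in F])) => F.
apply: (measurable_and_prop _ (F := [set w | forall u, M w u <-> u \in F])).
apply: (measurable_forall (F := fun u => [set w | M w u <-> u \in F])) => u.
by apply: measurable_iff_prop; exact: mM.
Qed.

End GaltonWatson.

Section GWProgeny.
Context {R : realType} (p q : nat -> R).
Hypothesis p_pmf : is_pmf p.
Hypothesis q01 : forall k, 0 <= q k <= 1.
Context d (Om : measurableType d) (P : probability Om R).
Context (tau : {RV P >-> tree}) (M : Om -> set word).
Hypothesis tauM : is_marked_GW p q tau M.

Local Notation pr A := (fine (P A)).
Local Notation tw := (type_weight p q).
Local Notation BB := (marked_cylinder tau M).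

Lemma eq_marked_weight s t S S' h : same_upto h s t ->
  {in younger t h, S =1 S'} -> marked_weight p q s S h = marked_weight p q t S' h.
Proof.
move=> st SS; rewrite /marked_weight (same_upto_younger st (leqnSn h)).
apply: eq_big_seq => u uy; rewrite SS //; have /in_younger[tu uh] := uy.
by rewrite (same_upto_nb_children st uh tu).
Qed.

Lemma marked_weightS t S h : marked_weight p q t S h.+1 =
  marked_weight p q t S h * \prod_(u <- level t h) tw (nb_children t u) (S u).
Proof. by rewrite /marked_weight (perm_big _ (younger_perm t h)) big_cat. Qed.

Lemma finite_tree_level (s : tree) (F : {fset word}) h :
  (forall u, s u -> u \in F) ->
  (size (younger s h) + size (level s h) + size (level s h.+1) <= #|` F|)%N.
Proof.
move=> sF; rewrite -!size_cat.
have e : perm_eq (younger s h.+2) ((younger s h ++ level s h) ++ level s h.+1).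
  by apply: perm_trans (younger_perm _ _) _; rewrite perm_cat2r younger_perm.
rewrite -(perm_size e); apply: uniq_leq_size; first exact: fset_uniq.
by move=> u /in_younger[su _]; exact: sF.
Qed.

Lemma extinct_youngerP (s t : tree) h : same_upto h s t -> size (level t h) = 0%N ->
  forall u, s u <-> u \in younger t h.
Proof.
move=> st l0 u; split=> [su|/in_younger[tu uh]]; last by apply/st; rewrite 1?ltnW.
apply/in_younger; have [uh|hu] := ltnP (size u) h.
  by split=> //; apply/st; rewrite 1?ltnW.
have : take h u \in level t h.
  have szt : size (take h u) = h by rewrite size_takel.
  apply/in_level; split=> //; apply/st; rewrite ?szt //.
  by apply: (@tree_prefix s _ (drop h u)); rewrite cat_take_drop.
by have -> := cardfs0_eq l0.
Qed.

Lemma GW_forest_extinct N h t S n : size (level t h) = 0%N ->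
  pr (BB t S h `&` (progeny_le tau (size (younger t h) + N) `&` mark_count M n)) =
  marked_weight p q t S h *
    mark_ind (\sum_(u <- younger t h) S u)%N n 0.
Proof.
move=> l0; rewrite -(pr_marked_cylinder tauM).
have mB := measurable_marked_cylinder tauM t S h.
have mX : measurable (BB t S h `&`
    (progeny_le tau (size (younger t h) + N) `&` mark_count M n)).
  apply: measurableI => //; apply: measurableI; first exact: measurable_progeny_le.
  exact: (measurable_mark_count tauM).
pose F : {fset word} := [fset u in younger t h | S u]%fset.
have cF : #|` F| = (\sum_(u <- younger t h) S u)%N.
  have e : perm_eq F [seq u <- younger t h | S u].
    apply: uniq_perm; rewrite ?fset_uniq ?filter_uniq ?fset_uniq // => u.
    by rewrite mem_filter !inE andbC.
  rewrite (perm_size e) size_filter; elim: (enum_fset _) => [|u s IH] /=.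
    by rewrite big_nil.
  by rewrite big_cons IH.
have MF w : BB t S h w -> ~ unmarkable tau M w -> forall u, M w u <-> u \in F.
  move=> [wt wS] /forallNP nw u; rewrite !inE; split.
    move=> Mu; have tu : tau w u by apply: contrapT => ntu; exact: (nw u).
    have uy : u \in younger t h by apply/(extinct_youngerP wt l0).
    by rewrite uy; apply/wS.
  by move=> /andP[uy Su]; apply/wS.
rewrite /mark_ind addn0 -cF; case: eqP => [cn|cn]; rewrite ?mulr1 ?mulr0.
  apply/eqP; rewrite eq_le; apply/andP; split.
    by apply: ler_pr => //; move=> w [].
  apply: (ler_pr_ae tauM) => // w [Bw nw]; split=> //; split.
    exists (younger t h); rewrite leq_addr; split=> //.
    by case: Bw => wt _ u; move/(extinct_youngerP wt l0).
  by apply/mark_countP; exists F; split=> //; exact: MF.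
apply/eqP; rewrite eq_le pr_ge0 andbT -(pr_set0 P).
apply: (ler_pr_ae tauM) => // w [[Bw [_ /mark_countP[G [Gn MG]]]] nw].
apply: cn; rewrite -Gn; congr (#|` _|); apply/fsetP => u.
by apply/idP/idP; [move/(MF _ Bw nw)/MG|move/MG/(MF _ Bw nw)].
Qed.

Lemma progeny_nb_children N w t S h u : BB t S h w ->
  progeny_le tau (size (younger t h) + N) w -> u \in level t h ->
  (nb_children (tau w) u + size (level t h) <= N)%N.
Proof.
move=> [wt _] [F [FN tF]] ul; have := leq_trans (finite_tree_level h tF) FN.
rewrite (same_upto_younger wt (leqnSn h)) (same_upto_level wt (leqnn h)).
rewrite -addnA leq_add2l addnC; apply: leq_trans; rewrite leq_add2r.
rewrite size_level (same_upto_level wt (leqnn h)).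
by rewrite (big_rem u ul) leq_addr.
Qed.

Definition vertex_type K (u : word) (w : Om) : 'I_K.+1 * bool :=
  (inord (nb_children (tau w) u), `[< M w u >]).

Lemma measurable_vertex_type K u x : measurable [set w | vertex_type K u w = x].
Proof.
have [_ mM _] := tauM.
rewrite (_ : [set _ | _] = tau @^-1` [set s : tree | inord (nb_children s u) = x.1] `&`
    [set w | M w u <-> x.2]).
  apply: measurableI; last by apply: measurable_iff_prop; exact: mM.
  apply: (measurable_funPTI tau).
  exact: (measurable_nb_children u (fun k => inord k = x.1)).
apply/seteqP; split=> w /=; rewrite /vertex_type.
  by move=> <- /=; split=> //; split=> [Mu|/asboolP//]; apply/asboolP.
move=> [-> Mu]; rewrite [RHS]surjective_pairing; congr (_, _).
by apply/asboolP/idP => /Mu.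
Qed.

Section Step.
Variables (N h K : nat) (t : tree) (S : word -> bool) (n : nat).
Variable x : seq ('I_K.+1 * bool).
Let L := level t h.
Let X := BB t S h `&`
  (progeny_le tau (size (younger t h) + (N + size L)) `&` mark_count M n).
Hypothesis KE : (K.+1 = N + size L)%N.
Hypothesis L0 : (0 < size L)%N.
Hypothesis sx : size x = size L.
Let xt u := nth (ord0, false) x (index u L).
Let xE : [seq xt u | u <- L] = x.
Proof. exact: map_nth_index (fset_uniq _) sx. Qed.
Let S' u := if u \in L then (xt u).2 else S u.

Lemma vertex_type_level w : X w -> [seq vertex_type K u w | u <- L] = x ->
  forall u, u \in L -> nb_children (tau w) u = (xt u).1 /\ (M w u <-> (xt u).2).
Proof.
move=> [Bw [pw _]] wx u uL.
have vu : vertex_type K u w = xt u.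
  by move: wx; rewrite -xE => /eq_in_map/(_ u uL).
rewrite -vu /=; split; last by split=> [Mu|/asboolP//]; apply/asboolP.
rewrite inordK // KE; have := progeny_nb_children Bw pw uL.
rewrite leq_add2r => nN; apply: leq_ltn_trans nN _.
by rewrite -[X in (X < _)%N]addn0 ltn_add2l.
Qed.

Lemma marked_cylinder_step t' : same_upto h t' t ->
  (forall u, u \in L -> outdeg t' u = (nat_of_ord (xt u).1)%:Z) ->
  X `&` [set w | [seq vertex_type K u w | u <- L] = x] =
  BB t' S' h.+1 `&`
    (progeny_le tau (size (younger t' h.+1) + N) `&` mark_count M n).
Proof.
move=> tt' to.
have lE : level t' h = L := same_upto_level tt' (leqnn h).
have yE : younger t' h = younger t h := same_upto_younger tt' (leqnSn h).
have szE : (size (younger t' h.+1) + N = size (younger t h) + (N + size L))%N.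
  by rewrite (perm_size (younger_perm t' h)) size_cat yE lE -addnA (addnC N).
have inyS u : u \in younger t' h.+1 = (u \in younger t h) || (u \in L).
  by rewrite (perm_mem (younger_perm t' h)) mem_cat yE lE.
have yL u : u \in younger t h -> u \in L = false.
  move=> /in_younger[_ uh]; apply/negbTE/negP => /in_level[_ uh'].
  by rewrite uh' ltnn in uh.
apply/seteqP; split=> w.
  move=> [Xw wx]; have vw := vertex_type_level Xw wx.
  case: Xw => [[wt wS] [pw mw]]; split; last by rewrite szE.
  split.
    apply/same_uptoS; split; first exact: same_upto_trans wt (same_upto_sym tt').
    move=> u [t'u uh]; have uL : u \in L by rewrite -lE; apply/in_level.
    have tu : t u by apply/tt'; rewrite ?uh.
    apply/outdeg_eqP; split; first by apply/wt; rewrite ?uh.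
    have [-> _] := vw u uL.
    by have /outdeg_eqP[_ ->] := to u uL.
  move=> u; rewrite inyS /S' => /orP[uy|uL]; first by rewrite yL //; exact: wS.
  by rewrite uL; have [] := vw u uL.
rewrite szE => -[[wt' wS'] [pw mw]].
have wt : same_upto h (tau w) t by exact: same_upto_trans (same_upto_le (leqnSn h) wt') tt'.
split; first (split; last by split).
  split=> // u uy; have := wS' u; rewrite inyS uy /S' yL //; exact.
rewrite /= -[RHS]xE; apply/eq_in_map => u uL.
have := wS' u; rewrite inyS uL orbT /S' uL => /(_ isT) Mu.
have /in_level[t'u uh] : u \in level t' h by rewrite lE.
rewrite /vertex_type (same_upto_nb_children wt' _ t'u) ?uh //.
have /outdeg_eqP[_ ->] := to u uL.
rewrite inord_val [RHS]surjective_pairing; congr (_, _).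
by apply/asboolP/idP => /Mu.
Qed.

Lemma GW_step_weight t' : same_upto h t' t ->
  (forall u, u \in L -> outdeg t' u = (nat_of_ord (xt u).1)%:Z) ->
  [/\ marked_weight p q t' S' h.+1 =
      marked_weight p q t S h * \prod_(r <- x) tw r.1 r.2,
      size (level t' h.+1) = degsum x &
      (\sum_(u <- younger t' h.+1) S' u =
      \sum_(u <- younger t h) S u + marksum x)%N].
Proof.
move=> tt' to.
have lE : level t' h = L := same_upto_level tt' (leqnn h).
have yE : younger t' h = younger t h := same_upto_younger tt' (leqnSn h).
have nbE u : u \in L -> nb_children t' u = (xt u).1.
  by move=> uL; have /outdeg_eqP[_ ->] := to u uL.
have yS u : u \in younger t h -> S' u = S u.
  move=> /in_younger[_ uh]; rewrite /S' ifF //; apply/negbTE/negP => /in_level[_ uh'].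
  by rewrite uh' ltnn in uh.
split.
- rewrite marked_weightS (eq_marked_weight tt' yS) lE; congr (_ * _).
  rewrite -xE big_map; apply: eq_big_seq => u uL.
  by rewrite nbE // /S' uL.
- rewrite size_level lE /degsum -[in RHS]xE big_map.
  by apply: eq_big_seq => u uL; rewrite nbE.
rewrite (perm_big _ (younger_perm t' h)) big_cat yE lE /=; congr (_ + _)%N.
  by apply: eq_big_seq => u uy; rewrite yS.
by rewrite /marksum -[in RHS]xE big_map; apply: eq_big_seq => u uL; rewrite /S' uL.
Qed.

Lemma GW_step_empty :
  ~ (exists t', same_upto h t' t /\
     forall u, u \in L -> outdeg t' u = (nat_of_ord (xt u).1)%:Z) ->
  X `&` [set w | [seq vertex_type K u w | u <- L] = x] = set0 /\
  marked_weight p q t S h * \prod_(r <- x) tw r.1 r.2 = 0.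
Proof.
move=> nt'; split.
  apply/seteqP; split=> // w [Xw wx]; apply: nt'; exists (tau w).
  have [[wt _] _] := Xw; split=> // u uL; apply/outdeg_eqP.
  have [-> _] := vertex_type_level Xw wx uL; split=> //.
  by have /in_level[tu uh] := uL; apply/wt; rewrite ?uh.
have := GW_level tauM h t (fun u => (xt u).1).
rewrite (_ : _ `&` _ = set0); last first.
  apply/seteqP; split=> // w [/= wo wt]; apply: nt'; exists (tau w); split=> //.
  by move=> u /in_level uL; apply: wo.
rewrite pr_set0 (GW_cylinder tauM) => e.
rewrite -xE big_map /marked_weight big_split /= [X in _ * X]big_split /=.
rewrite mulrACA -/(cylinder_weight p t h).
by rewrite -/L in e; rewrite -e mul0r.
Qed.

End Step.

Lemma GW_forest N h t S n :
  pr (BB t S h `&` (progeny_le tau (size (younger t h) + N) `&` mark_count M n)) =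
  marked_weight p q t S h *
    forestc p q N N (size (level t h)) (mark_ind (\sum_(u <- younger t h) S u)%N n).
Proof.
elim/ltn_ind: N h t S => N IH h t S.
have [l0|l0] := posnP (size (level t h)).
  by rewrite (GW_forest_extinct _ _ _ l0) l0 forestc0.
have [Nj|jN] := ltnP N (size (level t h)).
  rewrite (forestc_gt _ _ _ _ Nj) mulr0 (_ : _ `&` _ = set0) ?pr_set0 //.
  apply/seteqP; split=> // w [Bw [pw _]].
  have [u ul] : exists u, u \in level t h.
    by apply/fset0Pn; rewrite -cardfs_gt0.
  have := progeny_nb_children Bw pw ul; rewrite leqNgt => /negP; apply.
  by rewrite (leq_trans Nj) // leq_addl.
pose N' := (N - size (level t h))%N.
have NE : N = (N' + size (level t h))%N by rewrite subnK.
have N'N : (N' < N)%N by rewrite NE -[X in (X < _)%N]addn0 ltn_add2l.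
case: N => [|K] in IH jN N' NE N'N *; first by move: jN; rewrite leqn0 => /eqP j0; rewrite j0 in l0.
have mX : measurable (BB t S h `&`
    (progeny_le tau (size (younger t h) + K.+1) `&` mark_count M n)).
  apply: measurableI; first exact: (measurable_marked_cylinder tauM).
  by apply: measurableI; [exact: measurable_progeny_le|exact: (measurable_mark_count tauM)].
rewrite (pr_wordsum P (level t h) (measurable_vertex_type (K := K))) //.
rewrite [in RHS]NE -[X in forestc _ _ _ _ X]add0n forestc_explore -NE.
rewrite [in RHS]wordsum_weight -wordsumZ; apply: eq_wordsum => x sx.
rewrite mulrA; set m := (\sum_(u <- younger t h) S u)%N.
case: (pselect (exists t', same_upto h t' t /\ forall u, u \in level t h ->
    outdeg t' u = (nat_of_ord (nth (ord0, false) x (index u (level t h))).1)%:Z))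
  => [[t' [tt' to]]|nt'].
  rewrite {1}NE (marked_cylinder_step S n NE l0 sx tt' to) IH //.
  have [-> -> ->] := GW_step_weight S sx tt' to.
  rewrite add0n (@forestc_cutoff _ _ _ K.+1 N' N') // 1?ltnW //.
  by congr (_ * forestc _ _ _ _ _ _); apply/funext => y; rewrite /mark_ind addnA.
have := GW_step_empty S n NE l0 sx nt'; rewrite -NE => -[-> ->].
by rewrite pr_set0 mul0r.
Qed.

End GWProgeny.

Section LowerBound.
Context {R : realType} (p q : nat -> R).
Hypothesis p_pmf : is_pmf p.
Hypothesis p0 : 0 < p 0%N.
Hypothesis p01 : p 0%N + p 1%N < 1.
Hypothesis p_critical : mean p = 1%E.
Hypothesis q01 : forall k, 0 <= q k <= 1.
Hypothesis pq : exists k, 0 < p k * q k.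
Context d (Om : measurableType d) (P : probability Om R).
Context (tau : {RV P >-> tree}) (M : Om -> set word).
Hypothesis tauM : is_marked_GW p q tau M.

Let p_ge0 : forall k, 0 <= p k. Proof. by case: p_pmf. Qed.
Let tw_ge0 := type_weight_ge0 p_ge0 q01.
Local Notation pr A := (fine (P A)).
Local Notation tw := (type_weight p q).
Local Notation BB := (marked_cylinder tau M).
Local Notation a := (progeny_pmf p q).
Let m_count := measurable_mark_count tauM.
Let m_progeny := measurable_progeny_le tau.

Lemma mark_count_inj n n' w : mark_count M n w -> mark_count M n' w -> n = n'.
Proof.
move=> /mark_countP[F [<- MF]] /mark_countP[F' [<- MF']]; congr (#|` _|).
by apply/fsetP => u; apply/idP/idP; [move/MF/MF'|move/MF'/MF].
Qed.

Lemma sum_pr_mark_count_le k A : measurable A ->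
  \sum_(m < k) pr (A `&` mark_count M m) <= pr A.
Proof.
elim: k A => [|k IH] A mA; first by rewrite big_ord0 pr_ge0.
rewrite big_ord_recr /= (pr_splitC P mA (m_count k)) addrC lerD2l.
apply: le_trans (IH _ _); last by apply: measurableI => //; apply: measurableC.
apply: ler_sum => m _; apply: ler_pr.
- exact: measurableI.
- by apply: measurableI => //; apply: measurableI => //; exact: measurableC.
- move=> w [Aw mw]; split=> //; split=> // /(mark_count_inj mw) mk.
  by have := ltn_ord m; rewrite mk ltnn.
Qed.

Lemma pr_progeny_mark_count N n :
  pr (progeny_le tau N `&` mark_count M n) = forestc p q N N 1 (mark_ind 0 n).
Proof.
have := GW_forest tauM N 0 root_tree xpred0 n.
rewrite level0 younger0 !big_seq_fset0 /marked_weight younger0 big_seq_fset0 mul1r.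
rewrite cardfs0 add0n cardfs1 => <-; congr (fine (P _)).
apply/seteqP; split=> w; last by case.
move=> ?; split=> //; split; first exact: same_upto0.
by move=> u; rewrite younger0 inE.
Qed.

Lemma pr_mark_count_le n : pr (mark_count M n) <= a n.
Proof.
have c : (fun N => a n + (1 - forestc p q N N 1 (fun=> 1))) @ \oo --> a n + (1 - 1).
  apply: (cvgD (cvg_cst _) (cvgB (cvg_cst _) _)).
  exact: (forestc_total_cvg p_pmf p0 p01 p_critical q01 pq).
rewrite -[leRHS]addr0 -[X in _ <= _ + X](subrr 1).
apply: (cvgr_to_ge c); exists 0%N => // N _ /=.
rewrite (pr_splitC P (m_count n) (m_progeny N)) lerD //.
  rewrite setIC pr_progeny_mark_count.
  by apply: (forestc_le_lim p_pmf q01) => x; exact: mark_ind01.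
apply: (@le_trans _ _ (pr (~` progeny_le tau N))).
  apply: ler_pr; [|by apply: measurableC; exact: m_progeny|by move=> w []].
  by apply: (measurableI _ _ (m_count n)); apply: measurableC; exact: m_progeny.
rewrite (pr_setC P (m_progeny N)) lerD2l lerN2 forestc_expand.
apply: le_trans (sum_pr_mark_count_le N.+1 (m_progeny N)).
apply: ler_sum => m _; rewrite pr_progeny_mark_count mul1r le_eqVlt.
apply/orP; left; apply/eqP; congr forestc; apply/funext => x.
by rewrite /mark_ind add0n eq_sym.
Qed.

Lemma pr_marked_cylinder_ge t S h n :
  marked_weight p q t S h * forest_lim p q (size (level t h))
    (mark_ind (\sum_(u <- younger t h) S u)%N n) <=
  pr (BB t S h `&` mark_count M n).
Proof.
set m := (\sum_(u <- _) _)%N.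
have fc := forest_lim_cvg p_pmf q01 (j := size (level t h)) (g := mark_ind m n)
  (mark_ind01 m n).
apply: (cvgr_to_le (cvgM (cvg_cst (marked_weight p q t S h)) fc)).
exists 0%N => // N _ /=; rewrite -(GW_forest tauM).
have mB := measurable_marked_cylinder tauM t S h.
apply: ler_pr; [|exact: measurableI|by move=> w [? []]].
by apply: measurableI => //; apply: measurableI.
Qed.

Lemma marked_weight_ratio t S h : 0 < marked_weight p q t S h ->
  (0 < size (level t h))%N ->
  ratio_lower p q (size (level t h)) (\sum_(u <- younger t h) S u).
Proof.
elim: h => [|h IH].
  by rewrite younger0 level0 big_seq_fset0 cardfs1 => _ _; apply: ratio_lower1.
rewrite marked_weightS size_level => w0.
have [W0 L0] : 0 < marked_weight p q t S h /\
    0 < \prod_(u <- level t h) tw (nb_children t u) (S u).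
  have := w0; have W : 0 <= marked_weight p q t S h by apply: prodr_ge0.
  rewrite le0r in W; case/orP: W => [/eqP ->|W]; first by rewrite mul0r ltxx.
  by rewrite pmulr_rgt0.
move=> s0; have l0 : (0 < size (level t h))%N.
  by case: (enum_fset _) s0 => //; rewrite big_nil.
have := @ratio_lower_seq _ _ _ p_pmf p0 p01 p_critical q01 pq
  [seq (nb_children t u, S u) | u <- level t h] 0 _ _ _ _.
rewrite size_map addn0 !big_map add0n => /(_ (\sum_(u <- younger t h) S u)%N).
rewrite (perm_big _ (younger_perm t h)) big_cat; apply=> //; last exact: IH.
rewrite all_map; apply/allP => u ul /=; rewrite lt0r tw_ge0 andbT.
by apply: contraTneq L0 => tu0; rewrite (big_rem u ul) /= tu0 mul0r ltxx.
Qed.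

Lemma wordsum_eventually (T : finType) N (f : seq T -> R) (g : nat -> seq T -> R)
    (Q : nat -> Prop) :
  (forall x, size x = N ->
     exists n0, forall n, (n0 <= n)%N -> Q n -> f x <= g n x) ->
  exists n0, forall n, (n0 <= n)%N -> Q n ->
    wordsum (fun=> 1) N f <= wordsum (fun=> 1) N (g n).
Proof.
elim: N f g => [|N IH] f g H /=; first exact: H.
have H' t : exists n0, forall n, (n0 <= n)%N -> Q n ->
    wordsum (fun=> 1) N (fun x => f (t :: x)) <=
    wordsum (fun=> 1) N (fun x => g n (t :: x)).
  by apply: (IH (fun x => f (t :: x)) (fun n x => g n (t :: x))) => x sx; apply: H; rewrite /= sx.
have [n0 Hn0] := choice H'.
exists (\max_t n0 t)%N => n nn Qn; apply: ler_sum => t _; rewrite !mul1r.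
by apply: Hn0 => //; apply: leq_trans nn; exact: leq_bigmax.
Qed.

Lemma cylinder_mark_count_ge t h e : 0 < e ->
  exists n0, forall n, (n0 <= n)%N -> 0 < a n ->
    (1 - e) * ((size (level t h))%:R * cylinder_weight p t h) * a n <=
    pr ([set w | same_upto h (tau w) t] `&` mark_count M n).
Proof.
move=> e0; set L := younger t h; set j := size (level t h).
pose c (u : word) (w : Om) : bool := `[< M w u >].
pose Sx (x : seq bool) u := nth false x (index u L).
have mcyl : measurable [set w | same_upto h (tau w) t] by exact: measurable_cylinder.
have [_ mM _] := tauM.
have mc u b : measurable [set w | c u w = b].
  rewrite (_ : [set _ | _] = [set w | M w u <-> b]).
    by apply: measurable_iff_prop; exact: mM.
  apply/seteqP; split=> w /=; rewrite /c.
    by move=> <-; split=> [Mu|/asboolP//]; apply/asboolP.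
  by move=> Mu; apply/asboolP/idP => /Mu.
have cyl_x x : size x = size L ->
    [set w | same_upto h (tau w) t] `&` [set w | [seq c u w | u <- L] = x] =
    BB t (Sx x) h.
  move=> sx; have xE : [seq Sx x u | u <- L] = x := map_nth_index false (fset_uniq _) sx.
  apply/seteqP; split=> w [wt /= wx]; split=> //.
    move=> u uL; move: wx; rewrite -[in RHS]xE => /eq_in_map/(_ u uL) <-.
    by split=> [Mu|/asboolP//]; apply/asboolP.
  rewrite /= -[RHS]xE; apply/eq_in_map => u uL; have := wx u uL => Mu.
  by apply/asboolP/idP => /Mu.
have -> : cylinder_weight p t h =
    wordsum (fun=> 1) (size L) (fun x => marked_weight p q t (Sx x) h).
  rewrite -(GW_cylinder tauM) (pr_wordsum P L mc) //; apply: eq_wordsum => x sx.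
  by rewrite cyl_x // (pr_marked_cylinder tauM).
have [|n0 Hn0] := @wordsum_eventually _ (size L)
    (fun x => (1 - e) * j%:R * marked_weight p q t (Sx x) h)
    (fun n x => (a n)^-1 * pr (BB t (Sx x) h `&` mark_count M n))
    (fun n => 0 < a n).
  move=> x sx; set S := Sx x.
  have [j0|j0] := posnP j.
    exists 0%N => n _ an; rewrite j0 mulr0 mul0r mulr_ge0 ?pr_ge0 //.
    by rewrite invr_ge0 ltW.
  have : 0 <= marked_weight p q t S h by apply: prodr_ge0.
  rewrite le0r => /predU1P[->|W0].
    exists 0%N => n _ an; rewrite mulr0 mulr_ge0 ?pr_ge0 //.
    by rewrite invr_ge0 ltW.
  have [n0 Hn0] := marked_weight_ratio W0 j0 e0.
  exists n0 => n nn an; rewrite ler_pdivlMl //.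
  apply: le_trans (pr_marked_cylinder_ge t S h n).
  rewrite (_ : a n * _ = marked_weight p q t S h * ((1 - e) * a n * j%:R)); last by ring.
  by rewrite ler_pM2l // -ler_pdivlMr ?ltr0n //; exact: Hn0.
exists n0 => n nn an; have := Hn0 n nn an.
rewrite !wordsumZ -ler_pdivrMl ?invr_gt0 // invrK.
rewrite (_ : a n * _ = (1 - e) * (j%:R *
  wordsum (fun=> 1) (size L) (fun x => marked_weight p q t (Sx x) h)) * a n); last by ring.
move=> h1; apply: le_trans h1 _.
rewrite (pr_wordsum P L mc); last exact: measurableI.
rewrite le_eqVlt; apply/orP; left; apply/eqP; apply: eq_wordsum => x sx.
by rewrite -cyl_x // setIAC.
Qed.

(* Fatou direction only: the limit law having total mass one, lower bounds on
   cylinders will suffice. *)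
Lemma cond_cylinder_ge t h e : 0 < e <= 1 ->
  exists n0, forall n, (n0 <= n)%N -> (0 < P (mark_count M n))%E ->
    (1 - e) * ((size (level t h))%:R * cylinder_weight p t h) <=
    cond_prob P [set w | same_upto h (tau w) t] (mark_count M n).
Proof.
move=> /andP[e0 e1]; have [n0 H] := cylinder_mark_count_ge t h e0.
exists n0 => n nn; rewrite (prE P (m_count n)) lte_fin => Pn.
have an : 0 < a n by apply: lt_le_trans (pr_mark_count_le n).
rewrite /cond_prob ler_pdivlMr //; apply: le_trans (H n nn an).
rewrite ler_wpM2l ?pr_mark_count_le // mulr_ge0 ?subr_ge0 // mulr_ge0 //.
exact: prodr_ge0.
Qed.

End LowerBound.

(** * Convergence in law *)

Section FiniteValued.
Context {R : realType} d (T : measurableType d) (m : probability T R).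

Lemma bounded_integrable (f : T -> R) C : measurable_fun setT f ->
  (forall x, `|f x| <= C) -> m.-integrable setT (EFin \o f).
Proof.
move=> mf fC; apply: measurable_bounded_integrable => //.
  by rewrite [X in (X < _)%E](_ : _ = 1%E) ?ltry //; exact: probability_setT.
by exists C; split=> [|y Cy x _]; [exact: num_real|exact: le_trans (ltW Cy)].
Qed.

Lemma finite_valuedE (V : finType) (c : T -> V) (b : V -> R) s :
  b (c s) = \sum_i b i * \1_[set w | c w = i] s.
Proof.
rewrite (bigD1 (c s)) //= indicE mem_set // mulr1 big1 ?addr0 // => i ic.
by rewrite indicE memNset ?mulr0 // => /= ci; rewrite ci eqxx in ic.
Qed.

Lemma Rintegral_finite_valued (V : finType) (c : T -> V) (b : V -> R) :
  (forall i, measurable [set w | c w = i]) ->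
  m.-integrable setT (EFin \o (b \o c)) /\
  \int[m]_x b (c x) = \sum_i b i * fine (m [set w | c w = i]).
Proof.
move=> mc.
have m1 i : measurable_fun setT (\1_[set w | c w = i] : T -> R).
  by apply: measurable_indic.
have int1 i : m.-integrable setT (EFin \o (fun x => b i * \1_[set w | c w = i] x)).
  apply: (@bounded_integrable _ `|b i|); first by apply: measurable_funM.
  by move=> x; rewrite normrM ler_piMr // indicE; case: (_ \in _); rewrite ?normr1 ?normr0.
suff [h1 h2] : m.-integrable setT (EFin \o (fun x => \sum_i b i * \1_[set w | c w = i] x)) /\
    \int[m]_x (\sum_i b i * \1_[set w | c w = i] x) =
    \sum_i b i * fine (m [set w | c w = i]).
  have e : b \o c = (fun x => \sum_i b i * \1_[set w | c w = i] x).
    by apply/funext => x; exact: finite_valuedE.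
  by rewrite -[X in Rintegral _ _ X]/(b \o c) e; split.
elim: (index_enum V) => [|i r [IH1 IH2]].
  under eq_fun do rewrite big_nil; rewrite big_nil; split.
    by apply: (@bounded_integrable _ 0) => // x; rewrite normr0.
  by rewrite Rintegral_cst // mul0r.
under eq_fun do rewrite big_cons; rewrite big_cons; split.
  exact: (integrableD measurableT (int1 i) IH1).
rewrite RintegralD // IH2; congr (_ + _).
rewrite RintegralZl //; last first.
  apply: (@bounded_integrable _ 1) => // x.
  by rewrite indicE; case: (_ \in _); rewrite ?normr1 ?normr0.
by rewrite /Rintegral integral_indic // setIT.
Qed.

Lemma pr_nondecreasing_exhaust (E : nat -> set T) A e : 0 < e ->
  (forall i, measurable (E i)) -> measurable A ->
  (forall i j, (i <= j)%N -> E i `<=` E j) -> (forall w, A w <-> exists i, E i w) ->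
  exists i, fine (m A) - e <= fine (m (E i)).
Proof.
move=> e0 mE mA Eij AE.
have AU : A = \bigcup_i E i.
  by apply/seteqP; split=> w /=; [move/AE => [i]; exists i|move=> [i _ Ei]; apply/AE; exists i].
have : (m \o E) @ \oo --> m (\bigcup_n E n).
  apply: nondecreasing_cvg_mu => //; first by rewrite -AU.
  by move=> i j ij; apply/subsetPset/Eij.
rewrite -AU (prE m mA) => /fine_cvg /cvgrPdist_le/(_ e e0)[N _ /(_ N (leqnn N))] /= h.
by exists N; move: h; rewrite ler_norml => /andP[_]; rewrite lerBlDr addrC -lerBlDr.
Qed.

End FiniteValued.

Section Portmanteau.
Context {R : realType}.

Lemma same_upto_cvg (t_ : nat -> tree) (t : tree) :
  (forall h, same_upto h (t_ h) t) -> t_ @ \oo --> t.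
Proof.
move=> tt; apply/local_cvgE => u; apply: cvg_near_cst.
exists (size u).+1 => // h /= uh; rewrite /outdeg.
have tuE : t_ h u <-> t u by apply: tt; exact: ltnW.
case: asboolP => [su|nsu]; last by rewrite asboolF // => /tuE.
rewrite asboolT; last exact/tuE.
by rewrite (same_upto_nb_children (tt h) uh) //; apply/tuE.
Qed.

Lemma continuous_tree_measurable (f : tree -> R) : continuous f ->
  measurable_fun setT f.
Proof.
move=> /continuousP cf; apply: (measurability _ (measurable_realfun.RGenOpens.measurableE R)).
move=> _ [_ [a [b ->] <-]]; rewrite setTI; apply: sub_sigma_algebra.
by apply: cf; exact: interval_open.
Qed.

Definition tree_code h (t : tree) : nat :=
  choice.pickle (younger t h.+1 : {fset word}).

Lemma tree_codeP h s t : tree_code h s = tree_code h t <-> same_upto h s t.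
Proof.
split=> [|st]; last by rewrite /tree_code (same_upto_younger st).
move=> /(pcan_inj choice.pickleK) e u uh.
split=> tu.
  have : u \in younger t h.+1 by rewrite -e; apply/in_younger.
  by case/in_younger.
have : u \in younger s h.+1 by rewrite e; apply/in_younger.
by case/in_younger.
Qed.

Lemma measurable_cylinder_invariant h (A : set tree) :
  (forall s t, same_upto h s t -> A t -> A s) -> measurable A.
Proof.
move=> AP.
rewrite (_ : A = [set s | exists i, (exists t, tree_code h t = i /\ A t) /\ tree_code h s = i]);
  last first.
  apply/seteqP; split=> s /=.
    by move=> As; exists (tree_code h s); split=> //; exists s.
  move=> [i [[t [ti At]] si]]; apply: AP At; apply/tree_codeP.
  by rewrite ti.
apply: (measurable_exists (F := fun i => [set s |
  (exists t, tree_code h t = i /\ A t) /\ tree_code h s = i])) => i.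
apply: (measurable_and_prop _ (F := [set s | tree_code h s = i])).
have [[t <-]|nt] := pselect (exists t, tree_code h t = i).
  rewrite (_ : [set _ | _] = [set s | same_upto h s t]).
    exact: measurable_same_upto.
  by apply/seteqP; split=> s /= /tree_codeP.
rewrite (_ : [set _ | _] = set0) //; apply/seteqP; split=> // s /= si.
by apply: nt; exists s.
Qed.

Definition osc_le (f : tree -> R) e h : set tree :=
  [set s | forall s1 s2, same_upto h s1 s -> same_upto h s2 s ->
     `|f s1 - f s2| <= e].

Lemma osc_le_exhaust (f : tree -> R) e s : continuous f -> 0 < e ->
  exists h, osc_le f e h s.
Proof.
move=> cf e0; apply: contrapT => /forallNP H.
have {}H h : exists ss : tree * tree,
    [/\ same_upto h ss.1 s, same_upto h ss.2 s & e < `|f ss.1 - f ss.2|].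
  have := H h; move=> /existsNP[s1 /existsNP[s2 /not_implyP[h1 /not_implyP[h2 /negP]]]].
  by rewrite -ltNge => h3; exists (s1, s2).
have [ss Hss] := choice H.
have c1 : (fun h => f (ss h).1) @ \oo --> f s.
  have c0 : (fun h => (ss h).1) @ \oo --> s.
    by apply: same_upto_cvg => h; have [] := Hss h.
  exact: (cvg_comp _ _ c0 (cf s)).
have c2 : (fun h => f (ss h).2) @ \oo --> f s.
  have c0 : (fun h => (ss h).2) @ \oo --> s.
    by apply: same_upto_cvg => h; have [] := Hss h.
  exact: (cvg_comp _ _ c0 (cf s)).
have : (fun h => f (ss h).1 - f (ss h).2) @ \oo --> f s - f s by apply: cvgB.
rewrite subrr => /cvgrPdist_le/(_ e e0)[N _ /(_ N (leqnn N))] /=.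
by rewrite sub0r normrN leNgt; have [_ _ ->] := Hss N.
Qed.

(* [ord_max] collects the trees outside the [k] cylinders that are kept. *)
Definition tree_class (f : tree -> R) e h k (s : tree) : 'I_k.+1 :=
  if `[< osc_le f e h s >] && (tree_code h s < k)%N then inord (tree_code h s)
  else ord_max.

Lemma osc_le_invariant f e h s t : same_upto h s t -> osc_le f e h t -> osc_le f e h s.
Proof.
by move=> st ot s1 s2 h1 h2; apply: ot; [exact: same_upto_trans h1 st|exact: same_upto_trans h2 st].
Qed.

Lemma tree_class_invariant f e h k s t :
  same_upto h s t -> tree_class f e h k s = tree_class f e h k t.
Proof.
move=> st; rewrite /tree_class (_ : tree_code h s = tree_code h t); last exact/tree_codeP.
congr (if _ && _ then _ else _); apply/asboolP/asboolP; apply: osc_le_invariant => //.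
exact: same_upto_sym.
Qed.

Lemma measurable_tree_class f e h k i : measurable [set s | tree_class f e h k s = i].
Proof.
apply: (@measurable_cylinder_invariant h) => s t st /= <-.
exact: tree_class_invariant.
Qed.

Lemma tree_class_cylinder f e h k (i : 'I_k.+1) t : (i < k)%N ->
  tree_class f e h k t = i ->
  [set s | tree_class f e h k s = i] = [set s | same_upto h s t] /\
  forall s, tree_class f e h k s = i -> `|f s - f t| <= e.
Proof.
move=> ik.
have classP s : tree_class f e h k s = i -> osc_le f e h s /\ tree_code h s = i.
  rewrite /tree_class; case: ifPn => [/andP[/asboolP os sk] <-|_ im].
    by split=> //; rewrite inordK // ltnW.
  by rewrite -im /= ltnn in ik.
move=> ti; have [ot tc] := classP t ti.
have st s : tree_class f e h k s = i -> same_upto h s t.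
  by move=> /classP[_ sc]; apply/tree_codeP; rewrite sc tc.
split=> [|s /st ss]; last by apply: ot => // u _; split.
apply/seteqP; split=> s /=; first exact: st.
by move=> ss; rewrite -ti; exact: tree_class_invariant.
Qed.

Lemma tree_class_tight f e (m : probability tree R) del : continuous f ->
  0 < e -> 0 < del ->
  exists h k, fine (m [set s | tree_class f e h k s = ord_max]) <= del.
Proof.
move=> cf e0 d0.
have d20 : 0 < del / 2 by rewrite divr_gt0.
have mo h : measurable (osc_le f e h).
  by apply: (@measurable_cylinder_invariant h) => s t; exact: osc_le_invariant.
have [h Hh] : exists h, fine (m setT) - del / 2 <= fine (m (osc_le f e h)).
  apply: pr_nondecreasing_exhaust => //.
    move=> i j ij s os s1 s2 h1 h2; apply: os; exact: same_upto_le ij _.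
  by move=> s; split=> // _; exact: osc_le_exhaust.
have mk k : measurable (osc_le f e h `&` [set s | (tree_code h s < k)%N]).
  apply: measurableI => //; apply: (@measurable_cylinder_invariant h) => s t.
  by move=> /tree_codeP /= e' ; rewrite e'.
have [k Hk] : exists k, fine (m (osc_le f e h)) - del / 2 <=
    fine (m (osc_le f e h `&` [set s | (tree_code h s < k)%N])).
  apply: pr_nondecreasing_exhaust => //.
    by move=> i j ij s [os si]; split=> //=; exact: leq_trans si ij.
  move=> s; split=> [os|[i []]//]; exists (tree_code h s).+1; split=> //=.
exists h, k.
rewrite pr_setT in Hh.
apply: (@le_trans _ _ (fine (m (~` (osc_le f e h `&` [set s | (tree_code h s < k)%N]))))).
  apply: ler_pr; [exact: measurable_tree_class|exact: measurableC|].
  move=> s /= sm [os sk]; move: sm; rewrite /tree_class asboolT // sk /=.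
  by move=> /(congr1 val) /=; rewrite inordK ?ltnS 1?ltnW // => e'; rewrite /= e' ltnn in sk.
by rewrite pr_setC //; lra.
Qed.

Lemma Rintegral_lower_semicontinuous (F : set_system nat) (FF : Filter F)
    (mu_ : nat -> probability tree R) (mu : probability tree R) :
  (forall h t e, 0 < e -> \forall n \near F,
     fine (mu [set s | same_upto h s t]) - e <=
     fine (mu_ n [set s | same_upto h s t])) ->
  forall (f : tree -> R) C, continuous f -> (forall t, `|f t| <= C) ->
  forall e, 0 < e -> \forall n \near F,
     \int[mu]_t f t - e <= \int[mu_ n]_t f t.
Proof.
move=> cyl f C cf fC e e0.
have C0 : 0 <= C by apply: le_trans (fC root_tree).
have mf := continuous_tree_measurable cf.
have intf (m : probability tree R) := bounded_integrable m mf fC.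
pose del := e / (4 * (C + 1)).
have C1 : 0 < 4 * (C + 1) by lra.
have del0 : 0 < del by rewrite divr_gt0.
have e80 : 0 < e / 8 by lra.
have [h [k tight]] := tree_class_tight mu cf e80 del0.
pose cl := tree_class f (e / 8) h k.
have mcl i : measurable [set s | cl s = i] by exact: measurable_tree_class.
have Hr (i : 'I_k.+1) : exists t, forall s, cl s = i -> cl t = i.
  have [[t ti]|nt] := pselect (exists t, cl t = i); first by exists t.
  by exists root_tree => s si; case: nt; exists s.
have {Hr}[r Hr] := choice Hr.
pose lo (i : 'I_k.+1) := if (i < k)%N then f (r i) - e / 8 else - C.
pose up (i : 'I_k.+1) := if (i < k)%N then f (r i) + e / 8 else C.
have near_r s : (cl s < k)%N -> `|f s - f (r (cl s))| <= e / 8.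
  by move=> sk; have [_] := tree_class_cylinder sk (Hr _ s erefl); apply.
have lof s : lo (cl s) <= f s.
  rewrite /lo; case: ltnP => [/near_r|_]; last by have := fC s; rewrite ler_norml => /andP[].
  by rewrite ler_norml => /andP[? _]; lra.
have fup s : f s <= up (cl s).
  rewrite /up; case: ltnP => [/near_r|_]; last by have := fC s; rewrite ler_norml => /andP[].
  by rewrite ler_norml => /andP[_ ?]; lra.
pose eta := e / (8 * (C + 1) * k.+1%:R).
have D0 : 0 < 8 * (C + 1) * k.+1%:R by rewrite mulr_gt0 ?ltr0n //; lra.
have eta0 : 0 < eta by rewrite divr_gt0.
have ev : \forall n \near F, forall i : 'I_k.+1, (i < k)%N ->
    fine (mu [set s | cl s = i]) - eta <= fine (mu_ n [set s | cl s = i]).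
  apply: (@filter_forall nat 'I_k.+1 (fun i n => (i < k)%N ->
    fine (mu [set s | cl s = i]) - eta <= fine (mu_ n [set s | cl s = i]))) => i.
  have [[t ti]|nt] := pselect (exists t, cl t = i); last first.
    apply: nearW => n ik; rewrite (_ : [set s | _] = set0); last first.
      by apply/seteqP; split=> // s si; apply: nt; exists s.
    by rewrite !pr_set0 sub0r oppr_le0 ltW.
  apply: filterS (cyl h t eta eta0) => n H ik.
  by have [-> _] := tree_class_cylinder ik ti.
apply: filterS ev => n ev.
have [i1 e1] := Rintegral_finite_valued mu up mcl.
have [i2 e2] := Rintegral_finite_valued (mu_ n) lo mcl.
have h1 : \int[mu]_t f t <= \sum_i up i * fine (mu [set w | cl w = i]).
  by rewrite -e1; exact: (le_Rintegral measurableT (intf mu) i1 (fun s _ => fup s)).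
have h2 : \sum_i lo i * fine (mu_ n [set w | cl w = i]) <= \int[mu_ n]_t f t.
  by rewrite -e2; exact: (le_Rintegral measurableT i2 (intf (mu_ n)) (fun s _ => lof s)).
apply: le_trans h2; rewrite lerBlDr; apply: le_trans h1 _; rewrite -lerBlDl.
have tot (m : probability tree R) : \sum_i fine (m [set w | cl w = i]) = 1.
  rewrite -(pr_setT m) (pr_partition m mcl) //.
  by apply: eq_bigr => i _; rewrite setTI.
(* [C + lo] is nonnegative, so the cylinder bounds may be used termwise;
   the shift by [C] costs nothing as both laws have total mass one. *)
have sh (m : probability tree R) (b : 'I_k.+1 -> R) :
    \sum_i b i * fine (m [set w | cl w = i]) =
    \sum_i (b i + C) * fine (m [set w | cl w = i]) - C.
  apply/eqP; rewrite -subr_eq opprK -[X in _ + X]mulr1 -(tot m) mulr_sumr -big_split.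
  by apply/eqP; apply: eq_bigr => i _ /=; rewrite mulrDl.
rewrite (sh mu) (sh (mu_ n)) opprB addrA addrNK -sumrB.
rewrite big_ord_recr /= {2}/up {2}/lo ltnn.
pose x (i : 'I_k) := fine (mu [set w | cl w = widen_ord (leqnSn k) i]).
pose y (i : 'I_k) := fine (mu_ n [set w | cl w = widen_ord (leqnSn k) i]).
have sum_le1 (m : probability tree R) :
    \sum_(i < k) fine (m [set w | cl w = widen_ord (leqnSn k) i]) <= 1.
  by rewrite -(tot m) big_ord_recr /= lerDl pr_ge0.
apply: (@le_trans _ _ (\sum_(i < k) (2 * C * eta + e / 8 * (x i + y i)) + 2 * C * del)).
  apply: lerD.
    apply: ler_sum => i _; rewrite /up /lo /= ltn_ord -/(x i) -/(y i).
    have := ev (widen_ord (leqnSn k) i) (ltn_ord i); rewrite -/(x i) -/(y i).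
    have := fC (r (widen_ord (leqnSn k) i)); rewrite ler_norml => /andP[].
    move: (f _) (x i) (y i) => g u v g1 g2 uv.
    rewrite -subr_ge0 (_ : _ - _ = 2 * C * eta - (g + C) * (u - v)); last by field.
    rewrite subr_ge0; apply: (@le_trans _ _ ((g + C) * eta)).
      by apply: ler_wpM2l; lra.
    by apply: ler_wpM2r; [exact: ltW|lra].
  rewrite addNr mul0r subr0 (_ : C + C = 2 * C); last by ring.
  by apply: ler_wpM2l; [lra|exact: tight].
rewrite big_split /= sumr_const card_ord -mulr_sumr big_split /=.
have hx : \sum_(i < k) x i <= 1 := sum_le1 mu.
have hy : \sum_(i < k) y i <= 1 := sum_le1 (mu_ n).
have a1 : e / 8 * (\sum_(i < k) x i + \sum_(i < k) y i) <= e / 4.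
  by move: hx hy; set sx := \sum_(i < k) _; set sy := \sum_(i < k) _ => ? ?; nra.
have a2 : 2 * C * del <= e / 2.
  rewrite /del mulrA ler_pdivrMr // -subr_ge0.
  by rewrite (_ : _ - _ = 2 * e); [lra|field].
have a3 : 2 * C * eta *+ k <= e / 4.
  rewrite -mulr_natr /eta mulrA mulrAC ler_pdivrMr // -[k.+1%:R]natr1 -subr_ge0.
  rewrite (_ : _ - _ = 2 * e * (C + k%:R + 1)); last by field.
  by rewrite mulr_ge0 // ?addr_ge0 // mulr_ge0 // ltW.
lra.
Qed.

Lemma cvg_in_law_cylinders (F : set_system nat) (FF : Filter F)
    (mu_ : nat -> probability tree R) (mu : probability tree R) :
  (forall h t e, 0 < e -> \forall n \near F,
     fine (mu [set s | same_upto h s t]) - e <=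
     fine (mu_ n [set s | same_upto h s t])) ->
  cvg_in_law F mu_ mu.
Proof.
move=> cyl f cf [C fC].
have mf := continuous_tree_measurable cf.
have intf (m : probability tree R) := bounded_integrable m mf fC.
have fin (m : probability tree R) : (\int[m]_t (f t)%:E)%E = (\int[m]_t f t)%:E.
  by rewrite /Rintegral fineK // (integrable_fin_num _ (intf m)).
rewrite fin; apply/fine_cvgP; split.
  by apply: nearW => n; rewrite fin.
apply/cvgrPdist_le => e e0.
have cNf : continuous (fun t => - f t) by move=> t; exact: (cvgN (cf t)).
have fNC t : `|- f t| <= C by rewrite normrN.
have RN (m : probability tree R) : \int[m]_t (- f t) = - \int[m]_t f t.
  rewrite -mulN1r -RintegralZl //; last exact: intf.
  by apply: eq_Rintegral => t _; rewrite mulN1r.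
have lo := Rintegral_lower_semicontinuous FF cyl cf fC e0.
have up := Rintegral_lower_semicontinuous FF cyl cNf fNC e0.
apply: filterS2 lo up => n; rewrite !RN /= fin /= => lo up.
by rewrite ler_norml; apply/andP; split; lra.
Qed.

End Portmanteau.

(** * Kesten's tree *)

Section Kesten.
Context {R : realType} (p : nat -> R).
Hypothesis p_pmf : is_pmf p.
Hypothesis p_critical : mean p = 1%E.
Context d (Om : measurableType d) (P : probability Om R).
Context (tau : {RV P >-> tree}) (v : nat -> {RV P >-> nat}).
Hypothesis tauK : is_Kesten p tau v.

Local Notation pr A := (fine (P A)).

Let p_ge0 : forall k, 0 <= p k. Proof. by case: p_pmf. Qed.

Lemma measurable_spine h x : measurable [set w | spine v h w = x].
Proof.
rewrite (_ : [set _ | _] = [set w | forall k, size x = h /\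
    ((k < h)%N -> v k w = nth 0%N x k)]); last first.
  apply/seteqP; split=> w /=; rewrite /spine.
    by move=> <- k; rewrite size_mkseq; split=> // kh; rewrite nth_mkseq.
  move=> H; have [sx _] := H 0%N.
  apply: (@eq_from_nth _ 0%N); rewrite size_mkseq ?sx // => k kh.
  by rewrite nth_mkseq //; have [_] := H k; apply.
apply: (measurable_forall (F := fun k => [set w | size x = h /\
    ((k < h)%N -> v k w = nth 0%N x k)])) => k.
apply: (measurable_and_prop _ (F := [set w | (k < h)%N -> v k w = nth 0%N x k])).
apply: measurable_imply_prop.
exact: (measurable_funPTI (v k) (Y := [set nth 0%N x k])).
Qed.

Lemma measurable_cylinder_spine h h' t x :
  measurable [set w | same_upto h (tau w) t /\ spine v h' w = x].
Proof.
apply: (measurableI [set w | same_upto h (tau w) t]).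
  exact: measurable_cylinder.
exact: measurable_spine.
Qed.

Lemma spine_rcons h w x i : spine v h.+1 w = rcons x i <->
  spine v h w = x /\ v h w = i.
Proof.
rewrite /spine /mkseq -{1}addn1 iotaD map_cat /= cats1 add0n.
by split=> [/rcons_inj[-> ->]|[-> ->]].
Qed.

Lemma Kesten_cylinder_spine_le h t x : x \in level t h ->
  pr [set w | same_upto h (tau w) t /\ spine v h w = x] <= cylinder_weight p t h.
Proof.
have [_ K2 K3] := tauK; elim: h x => [|h IH] x.
  by rewrite /cylinder_weight younger0 big_seq_fset0 => _; apply/pr_le1/measurable_cylinder_spine.
case/lastP: x => [/in_level[]//|y i] /in_level[/tree_rconsP[ty ik]].
rewrite size_rcons => -[yh]; have yl : y \in level t h by apply/in_level.
set k := nb_children t y in ik.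
have k0 : k%:R != 0 :> R by rewrite pnatr_eq0; case: (k) ik => // ; rewrite leqn0; case: i.
pose B1 := [set w | same_upto h.+1 (tau w) t /\ spine v h w = y].
pose B0 := [set w | same_upto h (tau w) t /\ spine v h w = y].
have -> : [set w | same_upto h.+1 (tau w) t /\ spine v h.+1 w = rcons y i] =
    [set w | v h w = i] `&` B1.
  apply/seteqP; split=> w /=; first by move=> [? /spine_rcons[? ?]].
  by move=> [? [? ?]]; split=> //; apply/spine_rcons.
rewrite (cond_prob_mul (x := k%:R^-1)); last 3 first.
- exact: (measurable_funPTI (v h) (Y := [set i])).
- exact: measurable_cylinder_spine.
- by move=> B10; rewrite (K3 h t y B10 i) ik.
have -> : B1 = [set w | forall u, generation t h u ->
    outdeg (tau w) u = (nb_children t u)%:Z] `&` B0.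
  apply/seteqP; split=> w /=; first by move=> [/same_uptoS[? ?] ?].
  by move=> [? [? ?]]; split=> //; apply/same_uptoS.
rewrite (cond_prob_mul (x := \prod_(u <- level t h)
   (if u == y then size_biased p (nb_children t u) else p (nb_children t u)))); last 3 first.
- exact: measurable_level_outdeg.
- exact: measurable_cylinder_spine.
- move=> B00; rewrite (K2 h t y B00 (nb_children t)) fsbig_finite //.
  exact: finite_generation.
rewrite -mulrA (big_rem y yl) /= eqxx /size_biased p_critical /= divr1 -/k.
set Q := \prod_(u <- rem y _) _.
have -> : k%:R * p k * Q * k%:R^-1 = p k * Q by field.
have -> : Q = \prod_(u <- rem y (level t h)) p (nb_children t u).
  by apply: eq_big_seq => u; rewrite mem_rem_uniq ?fset_uniq // inE => /andP[/negPf -> //].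
rewrite /cylinder_weight (perm_big _ (younger_perm t h)) big_cat /=.
rewrite [X in _ <= _ * X](big_rem y yl) /= -/k.
by rewrite ler_wpM2r ?IH // mulr_ge0 // prodr_ge0.
Qed.

Lemma Kesten_cylinder_le h t :
  pr [set w | same_upto h (tau w) t] <=
  (size (level t h))%:R * cylinder_weight p t h.
Proof.
have [[N [mN N0 HN]] _ _] := tauK.
set L := level t h.
pose c w : 'I_(size L).+1 := inord (index (spine v h w) L).
have mc i : measurable [set w | c w = i].
  rewrite (_ : [set _ | _] = [set w | exists x, (inord (index x L) = i) /\ spine v h w = x]).
    apply: (measurable_exists (F := fun x =>
      [set w | (inord (index x L) = i) /\ spine v h w = x])) => x.
    apply: (measurable_and_prop _ (F := [set w | spine v h w = x])).
    exact: measurable_spine.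
  apply/seteqP; split=> w /=; first by move=> ?; exists (spine v h w).
  by move=> [x [xi sx]]; rewrite /c sx.
have mcyl := measurable_cylinder tau h t.
rewrite (pr_partition P mc mcyl) big_ord_recr /= [X in _ + X <= _](_ : _ = 0).
  rewrite addr0 mulrC mulr_natr -[X in _ *+ X]card_ord -sumr_const.
  apply: ler_sum => i _.
  have il : nth [::] L i \in L by apply: mem_nth.
  apply: le_trans (Kesten_cylinder_spine_le il); apply: ler_pr.
  - exact: measurableI.
  - exact: measurable_cylinder_spine.
  - move=> w [wt /= ci]; split=> //.
    have iE : index (spine v h w) L = i.
      have := congr1 val ci; rewrite /= inordK //.
      by rewrite ltnS index_size.
    by rewrite -iE nth_index // -index_mem iE.
apply/eqP; rewrite eq_le pr_ge0 andbT.
have -> : 0 = pr N by rewrite N0.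
apply: ler_pr => //; first exact: measurableI.
move=> w [wt /= ci]; apply: HN => -[sp _].
have : spine v h w \in L.
  have ssz : size (spine v h w) = h by rewrite size_mkseq.
  by apply/in_level; split=> //; apply/wt; rewrite ?ssz //; exact: sp.
rewrite -index_mem.
have := congr1 val ci; rewrite /= inordK ?ltnS ?index_size // => ->.
by rewrite ltnn.
Qed.

End Kesten.
Unset Implicit Arguments.
Theorem theorem3p3 (R : realType) (p q : nat -> R)
  (p_pmf : is_pmf p) (p0 : 0 < p 0%N) (p01 : p 0%N + p 1%N < 1)
  (p_critical : mean p = 1%E)
  (q01 : forall k, 0 <= q k <= 1)
  (pq : exists k, 0 < p k * q k)
  (* marked Galton-Watson tree *)
  (d : measure_display) (Om : measurableType d) (P : probability Om R)
  (tau : {RV P >-> tree}) (M : Om -> set word)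
  (tauM : is_marked_GW p q tau M)
  (* tau_n has the conditional law of tau given that Card M = n *)
  (dn : nat -> measure_display) (Omn : forall n, measurableType (dn n))
  (Pn : forall n, probability (Omn n) R)
  (tau_ : forall n, {RV (Pn n) >-> tree})
  (tau_law : forall n : nat, (0 < n)%N ->
     (0 < P [set w | (M w #= `I_n)%card])%E ->
     forall A : set tree, measurable A ->
       distribution (Pn n) (tau_ n) A =
       (cond_prob P (tau @^-1` A) [set w | (M w #= `I_n)%card])%:E)
  (* Kesten's tree with its spine *)
  (d' : measure_display) (Om' : measurableType d') (P' : probability Om' R)
  (tau' : {RV P' >-> tree}) (v : nat -> {RV P' >-> nat})
  (tau'_Kesten : is_Kesten p tau' v) :
  cvg_in_law
    (within [set n | (0 < n)%N /\ (0 < P [set w | (M w #= `I_n)%card])%E] \oo)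
    (fun n => distribution (Pn n) (tau_ n))
    (distribution P' tau').
Proof.
apply: cvg_in_law_cylinders.
move=> h t e e0; set A := [set s | same_upto h s t].
pose X := (size (level t h))%:R * cylinder_weight p t h.
have X0 : 0 <= X by rewrite mulr_ge0 // prodr_ge0 // => u _; case: p_pmf.
have mA : measurable A := measurable_same_upto h t.
have KA : fine (distribution P' tau' A) <= X.
  exact: (Kesten_cylinder_le p_pmf p_critical tau'_Kesten h t).
pose del := Num.min 1 (e / (X + 1)).
have X1 : 0 < X + 1 by lra.
have d01 : 0 < del <= 1 by rewrite lt_min ltr01 divr_gt0 //= ge_min lexx.
have dX : del * X <= e.
  have : del * (X + 1) <= e.
    by rewrite -ler_pdivlMr // ge_min lexx orbT.
  by case/andP: d01 => d0 _; lra.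
have [n0 H] := cond_cylinder_ge p_pmf p0 p01 p_critical q01 pq tauM t h d01.
exists n0 => // n /= nn [n_gt0 Mn].
have := H n nn Mn; rewrite -/X => ge.
rewrite (tau_law n n_gt0 Mn A mA) [fine _%:E]/=.
apply: le_trans ge; lra.
Qed.
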